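(* Let $R$ be a Noetherian commutative ring of Krull dimension at most $1$ such that $\mathrm{Q}(R)$ is Artinian, and let $\mathfrak{a}$ be a fractional ideal of $R$. Among all subrings $R\subseteq S\subseteq\mathrm{Q}(R)$ such that $S\mathfrak{a}$ is an invertible ideal of $S$, there exists a unique minimum with respect to inclusion. This ring is Noetherian as an $R$-module and equals $\mathfrak{a}^{n}:\mathfrak{a}^{n}$ for all integers $n\ge 0$ with $n+1\geq n(\mathfrak{a})$.
   Context: $\mathrm{Q}(R)$ is the total ring of fractions of $R$ (all regular elements inverted). For $R$-submodules $A,B\subseteq\mathrm{Q}(R)$, $A\cdot B$ is the $R$-module generated by all products $ab$ with $a\in A$, $b\in B$; $A^0=R$, $A^{k+1}=A^k\cdot A$; and $A:B=\{x\in\mathrm{Q}(R) : xB\subseteq A\}$. A fractional ideal of $R$ is a finitely generated $R$-submodule $\mathfrak{a}\subseteq\mathrm{Q}(R)$ with $\mathfrak{a}\cdot\mathrm{Q}(R)=\mathrm{Q}(R)$. For a ring $R\subseteq S\subseteq\mathrm{Q}(R)$ one has $\mathrm{Q}(S)=\mathrm{Q}(R)$, and an invertible ideal of $S$ is an $S$-submodule $\mathfrak{b}\subseteq\mathrm{Q}(S)$ for which some $S$-submodule $\mathfrak{c}\subseteq\mathrm{Q}(S)$ satisfies $\mathfrak{b}\cdot\mathfrak{c}=S$. $S\mathfrak{a}$ is the $S$-module generated by $\mathfrak{a}$. For a maximal ideal $\mathfrak{m}$ of $R$, $n(\mathfrak{m})$ is the minimal cardinality such that every ideal of $R_\mathfrak{m}$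 can be generated as an $R_\mathfrak{m}$-module by $n(\mathfrak{m})$ elements. For a fractional ideal, $n(\mathfrak{a})=\max\{n(\mathfrak{m}) : \mathfrak{m}\text{ a maximal ideal of }R\text{ with }\mathfrak{a}_\mathfrak{m}\neq R_\mathfrak{m}\}$, with the maximum of the empty set being $0$; here $\mathfrak{a}_\mathfrak{m}$ is viewed as an $R_\mathfrak{m}$-submodule of $\mathrm{Q}(R_\mathfrak{m})$ via the natural map $\mathrm{Q}(R)\to\mathrm{Q}(R_\mathfrak{m})$. *)

(* Defs.v *)
From HB Require Import structures.
From mathcomp Require Import all_boot all_order all_algebra generic_quotient.
From mathcomp Require Import all_classical.
From mathcomp Require Import ring.

Set Implicit Arguments.
Unset Strict Implicit.
Unset Printing Implicit Defensive.

Import GRing.Theory.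
Local Open Scope classical_set_scope.
Local Open Scope ring_scope.

(* Localization of an arbitrary commutative ring, possibly zero and possibly
   with zero divisors; [fraction.v] only covers integral domains. *)
Section Localization.
Local Open Scope quotient_scope.
Variables (R : comPzRingType) (S : mulrClosed R).

Definition ratio : Type := R * {s : R | s \in S}.

Implicit Types x y z : ratio.

Definition den x : R := val x.2.

Lemma den_in x : den x \in S. Proof. exact: valP x.2. Qed.

Definition mkratio (r s : R) (Ss : s \in S) : ratio := (r, exist _ s Ss).

(* The factor [u] is needed because [S] may contain zero divisors. *)
Definition loc_equiv x y : bool :=
  `[< exists2 u, u \in S & u * (x.1 * den y) = u * (y.1 * den x) >].

Lemma loc_equiv_refl : reflexive loc_equiv.
Proof. by move=> x; apply/asboolP; exists 1; rewrite ?rpred1. Qed.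

Lemma loc_equiv_sym : symmetric loc_equiv.
Proof.
by move=> x y; apply/asboolP/asboolP => -[u Su e]; exists u.
Qed.

Lemma loc_equiv_trans : transitive loc_equiv.
Proof.
move=> y x z /asboolP[u Su exy] /asboolP[v Sv eyz]; apply/asboolP.
exists (u * v * den y); first by rewrite !rpredM ?den_in.
have -> : u * v * den y * (x.1 * den z)
        = (v * den z) * (u * (x.1 * den y)) by ring.
rewrite exy.
have -> : v * den z * (u * (y.1 * den x))
        = (u * den x) * (v * (y.1 * den z)) by ring.
by rewrite eyz; ring.
Qed.

Canonical loc_equiv_equiv :=
  EquivRel loc_equiv loc_equiv_refl loc_equiv_sym loc_equiv_trans.

Definition loc : Type := {eq_quot loc_equiv}.
HB.instance Definition _ : EqQuotient _ loc_equiv loc := EqQuotient.on loc.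
HB.instance Definition _ := Choice.on loc.

Definition frac (r s : R) (Ss : s \in S) : loc := \pi_loc (mkratio r Ss).

Definition toloc (r : R) : loc := frac r (rpred1 S).

Lemma pi_eqP x y :
  reflect (exists2 u, u \in S & u * (x.1 * den y) = u * (y.1 * den x))
          (\pi_loc x == \pi_loc y).
Proof. by rewrite eqmodE; apply: asboolP. Qed.

Lemma repr_piP x : exists2 u, u \in S &
  u * ((repr (\pi_loc x)).1 * den x) = u * (x.1 * den (repr (\pi_loc x))).
Proof. by apply/pi_eqP; rewrite reprK. Qed.

Lemma locW (P : loc -> Prop) :
  (forall r s (Ss : s \in S), P (frac r Ss)) -> forall a, P a.
Proof. by move=> h; elim/quotW => -[r [s Ss]]; apply: h. Qed.

Lemma frac_eqP r s (Ss : s \in S) r' s' (Ss' : s' \in S) :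
  frac r Ss = frac r' Ss' <-> exists2 u, u \in S & u * (r * s') = u * (r' * s).
Proof. by split=> [/eqP/pi_eqP|h] //; apply/eqP/pi_eqP. Qed.

Definition addr_ratio x y : ratio :=
  mkratio (x.1 * den y + y.1 * den x) (rpredM (den_in x) (den_in y)).
Definition mulr_ratio x y : ratio :=
  mkratio (x.1 * y.1) (rpredM (den_in x) (den_in y)).
Definition oppr_ratio x : ratio := mkratio (- x.1) (den_in x).

Definition addloc (a b : loc) : loc := \pi_loc (addr_ratio (repr a) (repr b)).
Definition mulloc (a b : loc) : loc := \pi_loc (mulr_ratio (repr a) (repr b)).
Definition opploc (a : loc) : loc := \pi_loc (oppr_ratio (repr a)).

Lemma addloc_frac r s (Ss : s \in S) r' s' (Ss' : s' \in S) :
  addloc (frac r Ss) (frac r' Ss')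
  = frac (r * s' + r' * s) (rpredM Ss Ss').
Proof.
apply/eqP/pi_eqP; rewrite /frac.
have [u Su eu] := repr_piP (mkratio r Ss).
have [v Sv ev] := repr_piP (mkratio r' Ss').
move: (repr _) (repr _) eu ev => y x; rewrite /den /= -!/(den _) => eu ev.
exists (u * v); first by rewrite rpredM.
have -> : u * v * ((x.1 * den y + y.1 * den x) * (s * s'))
  = v * den y * s' * (u * (x.1 * s)) + u * den x * s * (v * (y.1 * s')) by ring.
by rewrite eu ev; ring.
Qed.

Lemma mulloc_frac r s (Ss : s \in S) r' s' (Ss' : s' \in S) :
  mulloc (frac r Ss) (frac r' Ss') = frac (r * r') (rpredM Ss Ss').
Proof.
apply/eqP/pi_eqP; rewrite /frac.
have [u Su eu] := repr_piP (mkratio r Ss).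
have [v Sv ev] := repr_piP (mkratio r' Ss').
move: (repr _) (repr _) eu ev => y x; rewrite /den /= -!/(den _) => eu ev.
exists (u * v); first by rewrite rpredM.
have -> : u * v * (x.1 * y.1 * (s * s'))
  = (u * (x.1 * s)) * (v * (y.1 * s')) by ring.
by rewrite eu ev; ring.
Qed.

Lemma opploc_frac r s (Ss : s \in S) : opploc (frac r Ss) = frac (- r) Ss.
Proof.
apply/eqP/pi_eqP; rewrite /frac.
have [u Su eu] := repr_piP (mkratio r Ss).
move: (repr _) eu => x; rewrite /den /= -!/(den _) => eu.
exists u => //; have -> : u * (- x.1 * s) = - (u * (x.1 * s)) by ring.
by rewrite eu; ring.
Qed.

Let ext := (addloc_frac, mulloc_frac, opploc_frac).

Lemma addlocA : associative addloc.
Proof.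
elim/locW=> a s Ss; elim/locW=> b t St; elim/locW=> c w Sw.
by rewrite !ext; apply/frac_eqP; exists 1; rewrite ?rpred1 //; ring.
Qed.

Lemma addlocC : commutative addloc.
Proof.
elim/locW=> a s Ss; elim/locW=> b t St.
by rewrite !ext; apply/frac_eqP; exists 1; rewrite ?rpred1 //; ring.
Qed.

Lemma add0loc : left_id (toloc 0) addloc.
Proof.
elim/locW=> a s Ss.
by rewrite !ext; apply/frac_eqP; exists 1; rewrite ?rpred1 //; ring.
Qed.

Lemma addNloc : left_inverse (toloc 0) opploc addloc.
Proof.
elim/locW=> a s Ss.
by rewrite !ext; apply/frac_eqP; exists 1; rewrite ?rpred1 //; ring.
Qed.

HB.instance Definition _ :=
  GRing.isZmodule.Build loc addlocA addlocC add0loc addNloc.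

Lemma mullocA : associative mulloc.
Proof.
elim/locW=> a s Ss; elim/locW=> b t St; elim/locW=> c w Sw.
by rewrite !ext; apply/frac_eqP; exists 1; rewrite ?rpred1 //; ring.
Qed.

Lemma mullocC : commutative mulloc.
Proof.
elim/locW=> a s Ss; elim/locW=> b t St.
by rewrite !ext; apply/frac_eqP; exists 1; rewrite ?rpred1 //; ring.
Qed.

Lemma mul1loc : left_id (toloc 1) mulloc.
Proof.
elim/locW=> a s Ss.
by rewrite !ext; apply/frac_eqP; exists 1; rewrite ?rpred1 //; ring.
Qed.

Lemma mullocDl : left_distributive mulloc addloc.
Proof.
elim/locW=> a s Ss; elim/locW=> b t St; elim/locW=> c w Sw.
by rewrite !ext; apply/frac_eqP; exists 1; rewrite ?rpred1 //; ring.
Qed.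

HB.instance Definition _ :=
  GRing.Zmodule_isComPzRing.Build loc mullocA mullocC mul1loc mullocDl.

Lemma toloc_is_zmod_morphism : zmod_morphism toloc.
Proof.
move=> r r'; rewrite -[RHS]/(addloc _ (opploc _)) /toloc !ext.
by apply/frac_eqP; exists 1; rewrite ?rpred1 //; ring.
Qed.

Lemma toloc_is_monoid_morphism : monoid_morphism toloc.
Proof.
split=> // r r'; rewrite -[RHS]/(mulloc _ _) /toloc !ext.
by apply/frac_eqP; exists 1; rewrite ?rpred1 //; ring.
Qed.

HB.instance Definition _ :=
  GRing.isZmodMorphism.Build R loc toloc toloc_is_zmod_morphism.
HB.instance Definition _ :=
  GRing.isMonoidMorphism.Build R loc toloc toloc_is_monoid_morphism.

Lemma mulr_frac r s (Ss : s \in S) r' s' (Ss' : s' \in S) :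
  frac r Ss * frac r' Ss' = frac (r * r') (rpredM Ss Ss').
Proof. exact: mulloc_frac. Qed.

Lemma mul_frac_den r s (Ss : s \in S) : frac r Ss * toloc s = toloc r.
Proof.
by rewrite mulr_frac; apply/frac_eqP; exists 1; rewrite ?rpred1 //; ring.
Qed.

Lemma toloc_eq0 r : toloc r = 0 <-> exists2 u, u \in S & u * r = 0.
Proof.
rewrite -[X in _ = X <-> _]/(toloc 0) /toloc frac_eqP.
by split=> -[u Su e]; exists u => //; move: e; rewrite !(mulr1, mulr0, mul0r).
Qed.

End Localization.

(* The map [r / s |-> f r / f s] induced by a ring morphism [f] that sends [S]
   into [S']. *)
Section LocMap.
Variables (R R' : comPzRingType) (S : mulrClosed R) (S' : mulrClosed R').
Variables (f : {rmorphism R -> R'}) (fS : forall s, s \in S -> f s \in S').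

Definition locmap (a : loc S) : loc S' :=
  frac (f (repr a).1) (fS (den_in (repr a))).

Lemma locmap_frac r s (Ss : s \in S) : locmap (frac r Ss) = frac (f r) (fS Ss).
Proof.
rewrite /locmap; apply/frac_eqP.
have [u Su eu] := repr_piP (mkratio r Ss); exists (f u); first exact: fS.
by rewrite -!rmorphM eu.
Qed.

End LocMap.

Section Ideals.
Variable Q : comPzRingType.
Implicit Types (S A B : set Q).

(* [A] is a submodule of [Q] over the subring [S] of [Q]; for [S = setT] these
   are the ideals of [Q]. *)
Definition submodule S A : Prop :=
  [/\ A 0, (forall x y, A x -> A y -> A (x + y))
         & (forall s x, S s -> A x -> A (s * x))].

Definition span S A : set Q := smallest (submodule S) A.

Definition generated_by S A (k : nat) : Prop :=
  exists2 s : seq Q, size s = k & A = span S [set` s].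

Definition finitely_generated S A : Prop := exists k, generated_by S A k.

Definition noetherian_module S A : Prop :=
  forall B, submodule S B -> B `<=` A -> finitely_generated S B.

Definition noetherian_ring : Prop := noetherian_module setT setT.

Definition artinian_ring : Prop :=
  forall I : nat -> set Q, (forall i, submodule setT (I i)) ->
    (forall i, I i.+1 `<=` I i) ->
    exists N, forall i, (N <= i)%N -> I i = I N.

Definition prime_ideal A : Prop :=
  [/\ submodule setT A, ~ A 1 & forall x y, A (x * y) -> A x \/ A y].

Definition maximal_ideal A : Prop :=
  [/\ submodule setT A, ~ A 1
    & forall B, submodule setT B -> ~ B 1 -> A `<=` B -> B = A].

(* There is no strict chain [p 0 < ... < p d.+1] of prime ideals. *)
Definition krull_dim_le (d : nat) : Prop :=
  ~ exists p : nat -> set Q,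
      (forall i, (i <= d.+1)%N -> prime_ideal (p i)) /\
      (forall i, (i <= d)%N -> p i `<` p i.+1).

Definition prodm S A B : set Q :=
  span S [set x | exists a b, [/\ A a, B b & x = a * b]].

Definition colon A B : set Q := [set x | forall b, B b -> A (x * b)].

Definition powm S A (k : nat) : set Q := iter k (fun C => prodm S C A) S.

Definition invertible_ideal S A : Prop :=
  submodule S A /\ exists2 C, submodule S C & prodm S A C = S.

End Ideals.

Arguments noetherian_ring : clear implicits.
Arguments artinian_ring : clear implicits.
Arguments krull_dim_le : clear implicits.

Section TotalFractions.
Variable R : comPzRingType.

Definition nonzerodiv : {pred R} := fun x => `[< GRing.lreg x >].

Lemma nonzerodivP x : reflect (forall y, x * y = 0 -> y = 0) (x \in nonzerodiv).
Proof.
apply: (iffP (asboolP _)) => [xreg y xy0|xreg y z xyz].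
  by apply: xreg; rewrite xy0 mulr0.
by apply/eqP; rewrite -subr_eq0; apply/eqP/xreg; rewrite mulrBr xyz subrr.
Qed.

Lemma nonzerodiv_1 : 1 \in nonzerodiv.
Proof. by apply/nonzerodivP => y; rewrite mul1r. Qed.

Lemma nonzerodiv_M : GRing.mulr_2closed nonzerodiv.
Proof.
move=> x y /nonzerodivP xreg /nonzerodivP yreg; apply/nonzerodivP => z.
by rewrite -mulrA => /xreg/yreg.
Qed.

HB.instance Definition _ := GRing.isMul2Closed.Build R nonzerodiv nonzerodiv_M.
HB.instance Definition _ := GRing.isMul1Closed.Build R nonzerodiv nonzerodiv_1.

Definition totfrac : comPzRingType := loc nonzerodiv.

(* The ring [R] as a subring of [Q(R)]. *)
Definition base : set totfrac := range (@toloc R nonzerodiv).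

Lemma toloc_totfrac_inj : injective (@toloc R nonzerodiv).
Proof.
apply: raddf_inj => r /toloc_eq0[u /nonzerodivP ureg ur0]; exact: ureg.
Qed.

Definition intermediate_ring (S : set totfrac) : Prop :=
  [/\ base `<=` S, (forall x y, S x -> S y -> S (x - y))
    & (forall x y, S x -> S y -> S (x * y))].

Definition fractional_ideal (a : set totfrac) : Prop :=
  [/\ submodule base a, finitely_generated base a & prodm base a setT = setT].

End TotalFractions.

Arguments nonzerodiv : clear implicits.
Arguments base : clear implicits.

Record maxIdeal (R : comPzRingType) := MaxIdeal {
  maxideal_set :> set R;
  maxidealP : maximal_ideal maxideal_set }.

Section MaximalLocalization.
Variables (R : comPzRingType) (m : maxIdeal R).

Definition maxcompl : {pred R} := fun x => `[< ~ maxideal_set m x >].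

Lemma maxcomplP x : reflect (~ maxideal_set m x) (x \in maxcompl).
Proof. exact: asboolP. Qed.

Lemma maxcompl_1 : 1 \in maxcompl.
Proof. by apply/maxcomplP; case: (maxidealP m). Qed.

Lemma maxcompl_M : GRing.mulr_2closed maxcompl.
Proof.
have [[m0 mD mM] m1 mmax] := maxidealP m.
move=> x y /maxcomplP nmx /maxcomplP nmy; apply/maxcomplP => mxy; apply: nmy.
pose J := [set z | exists t c, maxideal_set m t /\ z = t + c * x].
have mJ : maxideal_set m `<=` J.
  by move=> t mt; exists t, 0; rewrite mul0r addr0.
have JI : submodule setT J.
  split; first exact: mJ.
    move=> _ _ [t [c [mt ->]]] [t' [c' [mt' ->]]].
    by exists (t + t'), (c + c'); split; [exact: mD|ring].
  move=> s _ _ [t [c [mt ->]]].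
  by exists (s * t), (s * c); split; [exact: mM|ring].
have [[t [c [mt e]]]|nJ1] := pselect (J 1).
  have -> : y = y * t + c * (x * y).
    by rewrite -[LHS]mul1r e; ring.
  by apply: mD; apply: mM.
case: nmx; rewrite -(mmax J JI nJ1 mJ).
by exists 0, 1; split=> //; ring.
Qed.

HB.instance Definition _ := GRing.isMul2Closed.Build R maxcompl maxcompl_M.
HB.instance Definition _ := GRing.isMul1Closed.Build R maxcompl maxcompl_1.

Definition locmax : comPzRingType := loc maxcompl.

Lemma toloc_maxcompl_reg (s : R) : s \in nonzerodiv R ->
  toloc maxcompl s \in nonzerodiv locmax.
Proof.
move=> /nonzerodivP sreg; apply/nonzerodivP; elim/locW => r t Tt e.
have {e}/toloc_eq0[u Tu] : toloc maxcompl (s * r) = 0.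
  transitivity (toloc maxcompl s * (frac r Tt * toloc maxcompl t)).
    by rewrite mul_frac_den; exact: rmorphM.
  by rewrite mulrA e mul0r.
rewrite mulrCA => /sreg ur0.
rewrite -[0]/(toloc maxcompl 0); apply/frac_eqP; exists u => //.
by rewrite mulr1 ur0 mul0r mulr0.
Qed.

(* The natural map from [Q(R)] to [Q(R_m)]. *)
Definition totfrac_map : totfrac R -> totfrac locmax :=
  locmap (f := toloc maxcompl) toloc_maxcompl_reg.

(* [a_m], as an [R_m]-submodule of [Q(R_m)]. *)
Definition local_at (a : set (totfrac R)) : set (totfrac locmax) :=
  span (base locmax) (totfrac_map @` a).

End MaximalLocalization.

Arguments totfrac_map {R} m.
Arguments local_at {R} m a.

(* Natural numbers extended by an infinite element [None]. *)
Definition enat_le (x : option nat) (k : nat) : Prop :=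
  if x is Some j then (j <= k)%N else False.

(* The least element of a set of natural numbers, infinite for the empty set. *)
Definition enat_min (P : set nat) : option nat :=
  if pselect (exists k, `[< P k >]) is left h then Some (ex_minn h) else None.

Definition num_gens (R : comPzRingType) (m : maxIdeal R) : option nat :=
  enat_min [set k | forall I : set (locmax m),
    submodule setT I -> generated_by setT I k].

(* The maximum of a set of natural numbers is its least upper bound, which is
   moreover [0] for the empty set; it is infinite for an unbounded set. *)
Definition num_gens_frac (R : comPzRingType) (a : set (totfrac R)) :
  option nat :=
  enat_min [set k | forall m : maxIdeal R,
    local_at m a <> base (locmax m) -> enat_le (num_gens m) k].

Definition invertible_over (R : comPzRingType) (a S : set (totfrac R)) : Prop :=
  intermediate_ring S /\ invertible_ideal S (span S a).

Definition least_invertible_over (R : comPzRingType)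
    (a S : set (totfrac R)) : Prop :=
  invertible_over a S /\ forall T, invertible_over a T -> S `<=` T.

(* Main.v *)
(* Write [K n] for [a^n : a^(n+1)]. If [1] lies in [a * K n], then [a] becomes
   invertible over [S n = a^n : a^n], with inverse [K n]; conversely, cancelling
   the invertible ideal [T a] shows that every admissible ring [T] contains all
   the [S n]. So it suffices to find, for each maximal ideal [m], an element of
   [a * K n] outside [m], when [n + 1 >= n(a)] and also for some [n] at all.

   Suppose that [a^(n+1)] is generated by [n + 1] elements locally at [m]. In
   the spirit of Eakin and Sathaye, a generic element [f] of [a] then satisfies
   [a^(n+1) = f a^n]. As the residue field may be finite, [f] is chosen in
   [a[X]], and the identity holds in [Q[X]] localized at the prime [m[X]]: there
   is [u] in [R[X]], outside [m[X]], with [u a^(n+1) <= f a^n[X]]. Hence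
   [u = f g] with [g] in [K n [X]], so that the coefficients of [u] lie in
   [a * K n], and one of them lies outside [m].

   If [n + 1 >= n(a)] this applies at every [m] with [a_m <> R_m]. A suitable
   [n] exists in any case: [a] contains a unit of [Q], so there is a regular [c]
   in [R] such that [a_m = R_m] unless [c] is in [m], and comparing lengths along
   [R > I > c I] and [R > c R > c I] shows that [I / c I] has length at most that
   of [R / c R], which is finite, for every ideal [I] isomorphic to a power of
   [a]. *)

From HB Require Import structures.
From mathcomp Require Import all_boot all_order all_algebra all_classical.
From mathcomp Require Import ring zify.
Require Import Defs.

Set Implicit Arguments.
Unset Strict Implicit.
Unset Printing Implicit Defensive.

Import GRing.Theory.
Local Open Scope classical_set_scope.
Local Open Scope ring_scope.

(** * Submodules of a ring over a subring: spans, products, sums, linear combinations *)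

Definition subring (Q : comPzRingType) (D : set Q) : Prop :=
  [/\ D 1, forall x y, D x -> D y -> D (x - y)
    & forall x y, D x -> D y -> D (x * y)].

Definition addm (Q : comPzRingType) (A B : set Q) : set Q :=
  [set x | exists2 a, A a & exists2 b, B b & x = a + b].

Definition scalem (Q : comPzRingType) (x : Q) (A : set Q) : set Q :=
  [set y | exists2 a, A a & y = x * a].

(** The coefficients come from an arbitrary [C]: for an ideal [C] of [D] this is [C N], with [N] the
    [D]-module generated by [zs], as needed for Nakayama's lemma. *)
Fixpoint lincomb (Q : comPzRingType) (C : set Q) (zs : seq Q) : set Q :=
  if zs is z :: zs' then addm (scalem z C) (lincomb C zs') else [set 0].

Section Submodules.
Variables (Q : comPzRingType) (D : set Q).
Implicit Types (A B C M N V : set Q) (s zs : seq Q).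

Lemma submodule0 A : submodule D A -> A 0. Proof. by case. Qed.

Lemma submoduleD A x y : submodule D A -> A x -> A y -> A (x + y).
Proof. by case=> _ h _; apply: h. Qed.

Lemma submoduleM A c x : submodule D A -> D c -> A x -> A (c * x).
Proof. by case=> _ _; apply. Qed.

Lemma span_sub A : A `<=` span D A.
Proof. exact: sub_gen_smallest. Qed.

Lemma span_min A V : submodule D V -> A `<=` V -> span D A `<=` V.
Proof. by move=> hV AV x; apply. Qed.

Lemma span_submodule A : submodule D (span D A).
Proof.
split=> [|x y hx hy|c x hc hx] V [hV AV].
- exact: submodule0 hV.
- by apply: (submoduleD hV); [exact: (hx V)|exact: (hy V)].
- by apply: (submoduleM hV hc); exact: (hx V).
Qed.

Lemma span_mono A B : A `<=` B -> span D A `<=` span D B.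
Proof.
by move=> AB; apply: span_min (span_submodule B) _ => x /AB; apply: span_sub.
Qed.

Lemma prodm_submodule A B : submodule D (prodm D A B).
Proof. exact: span_submodule. Qed.

Lemma prodm_mul A B x y : A x -> B y -> prodm D A B (x * y).
Proof. by move=> Ax By; apply: span_sub; exists x, y. Qed.

Lemma prodm_min A B V : submodule D V ->
  (forall x y, A x -> B y -> V (x * y)) -> prodm D A B `<=` V.
Proof.
by move=> hV h; apply: span_min => // _ [x [y [Ax By ->]]]; apply: h.
Qed.

Lemma powm_submodule A n : submodule D D -> submodule D (powm D A n).
Proof. by move=> hD; case: n => [|n] //; apply: prodm_submodule. Qed.

Lemma powm_expr A x n : D 1 -> A x -> powm D A n (x ^+ n).
Proof.
by move=> D1 Ax; elim: n => [//|n IH]; rewrite exprSr; apply: prodm_mul.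
Qed.

Lemma colonX_submodule A z : submodule D A -> submodule D [set x | A (x * z)].
Proof.
move=> hA; split=> [|x y|c x hc] /=.
- by rewrite mul0r; apply: submodule0 hA.
- by rewrite mulrDl; apply: submoduleD.
- by rewrite -mulrA; apply: submoduleM.
Qed.

Lemma submoduleI A B : submodule D A -> submodule D B -> submodule D (A `&` B).
Proof.
move=> hA hB; split=> [|x y [? ?] [? ?]|c x ? [? ?]].
- by split; [apply: submodule0 hA|apply: submodule0 hB].
- by split; [apply: (submoduleD hA)|apply: (submoduleD hB)].
- by split; [apply: (submoduleM hA)|apply: (submoduleM hB)].
Qed.

Lemma addm_submodule A B :
  submodule D A -> submodule D B -> submodule D (addm A B).
Proof.
move=> hA hB; split.
- exists 0; [exact: submodule0 hA|exists 0; rewrite ?addr0 //].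
  exact: submodule0 hB.
- move=> _ _ [x Ax [y By ->]] [x' Ax' [y' By' ->]].
  exists (x + x'); [by apply: (submoduleD hA)|exists (y + y')].
    by apply: (submoduleD hB).
  by ring.
- move=> c _ Dc [x Ax [y By ->]].
  exists (c * x); [by apply: (submoduleM hA)|exists (c * y)].
    by apply: (submoduleM hB).
  by ring.
Qed.

Lemma addmSl A B : submodule D B -> A `<=` addm A B.
Proof.
by move=> hB x Ax; exists x => //; exists 0; rewrite ?addr0 //; case: hB.
Qed.

Lemma addmSr A B : submodule D A -> B `<=` addm A B.
Proof.
by move=> hA x Bx; exists 0; [case: hA|exists x; rewrite ?add0r].
Qed.

Lemma addm_min A B V : submodule D V -> A `<=` V -> B `<=` V ->
  addm A B `<=` V.
Proof.
by move=> hV AV BV _ [x /AV ? [y /BV ? ->]]; apply: (submoduleD hV).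
Qed.

Lemma scalem_submodule z A : submodule D A -> submodule D (scalem z A).
Proof.
move=> hA; split.
- by exists 0; rewrite ?mulr0 //; case: hA.
- move=> _ _ [x Ax ->] [y Ay ->]; exists (x + y); last by ring.
  by apply: (submoduleD hA).
- move=> c _ Dc [x Ax ->]; exists (c * x); last by ring.
  by apply: (submoduleM hA).
Qed.

Lemma lincomb_submodule C zs : submodule D C -> submodule D (lincomb C zs).
Proof.
move=> hC; elim: zs => [|z zs IH] /=.
  split=> [//|_ _ -> ->|c _ _ ->]; rewrite ?addr0 ?mulr0 //.
by apply: addm_submodule => //; apply: scalem_submodule.
Qed.

Lemma lincomb_mem C zs z c :
  submodule D C -> C c -> z \in zs -> lincomb C zs (c * z).
Proof.
move=> hC Cc; elim: zs => // y zs IH; rewrite inE => /orP[/eqP->|/IH h] /=.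
  by apply: addmSl; [exact: lincomb_submodule|exists c; rewrite ?[y * _]mulrC].
by apply: addmSr => //; apply: scalem_submodule.
Qed.

Lemma lincomb_min C zs V : submodule D V ->
  (forall c z, C c -> z \in zs -> V (c * z)) -> lincomb C zs `<=` V.
Proof.
move=> hV; elim: zs => [|z zs IH] h /=.
  by move=> _ ->; apply: submodule0 hV.
apply: addm_min => //.
  by move=> _ [c Cc ->]; rewrite mulrC; apply: h => //; rewrite inE eqxx.
by apply: IH => c y Cc yzs; apply: h => //; rewrite inE yzs orbT.
Qed.

Lemma span_seq zs : D 1 -> submodule D D -> span D [set` zs] = lincomb D zs.
Proof.
move=> D1 hD; apply/seteqP; split.
  apply: span_min; first exact: lincomb_submodule.
  by move=> z /= zzs; rewrite -[z]mul1r; apply: lincomb_mem.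
apply: lincomb_min; first exact: span_submodule.
move=> c z Dc zzs; apply: (submoduleM (span_submodule _) Dc).
exact: span_sub.
Qed.

Hypothesis Dring : subring D.

Lemma subring0 : D 0.
Proof. by case: Dring => h hB _; rewrite -(subrr 1); apply: hB. Qed.

Lemma subring1 : D 1. Proof. by case: Dring. Qed.

Lemma subringM x y : D x -> D y -> D (x * y).
Proof. by case: Dring => _ _; apply. Qed.

Lemma subringB x y : D x -> D y -> D (x - y).
Proof. by case: Dring => _ h _; apply: h. Qed.

Lemma subringN x : D x -> D (- x).
Proof. by move=> ?; rewrite -sub0r; apply: subringB => //;
  apply: subring0. Qed.

Lemma subringD x y : D x -> D y -> D (x + y).
Proof. by move=> ? ?; rewrite -[y]opprK; apply: subringB => //;
  apply: subringN. Qed.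

Lemma subring_submodule : submodule D D.
Proof. split; [exact: subring0|exact: subringD|exact: subringM]. Qed.

Lemma submoduleN A x : submodule D A -> A x -> A (- x).
Proof.
move=> hA Ax; rewrite -mulN1r; apply: (submoduleM hA _ Ax).
exact/subringN/subring1.
Qed.

Lemma submoduleB A x y : submodule D A -> A x -> A y -> A (x - y).
Proof. by move=> hA Ax Ay; apply: submoduleD => //; apply: submoduleN. Qed.

Lemma submoduleDl A x y : submodule D A -> A x -> A (x + y) -> A y.
Proof.
by move=> hA Ax Axy; rewrite -(addKr x y) addrC; apply: submoduleB.
Qed.

End Submodules.

Lemma setT_subring (Q : comPzRingType) : subring (setT : set Q).
Proof. by []. Qed.

(** * Lengths of localized modules, measured by chains of saturated submodules *)

Section Chains.
Variables (Q : comPzRingType) (D U : set Q).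
Implicit Types (A B C M N V O : set Q) (zs : seq Q).

(** For a submodule [A] and a multiplicative [U], this is the preimage in [Q] of the localization of
    [A] at [U]; local inclusions are thus stated inside [Q]. *)
Definition sat A : set Q := [set x | exists2 u, U u & A (u * x)].

Definition saturated A : Prop :=
  submodule D A /\ forall u x, U u -> A (u * x) -> A x.

(* There are saturated submodules [C_1, ..., C_k] of [B] such that
   [A < C_1 < ... < C_k]; [k <= length (B / A)] in the localization at [U]. *)
Fixpoint chain (k : nat) A B : Prop :=
  if k is k'.+1 then
    exists C, [/\ saturated C, A `<` C, C `<=` B & chain k' C B]
  else True.

Definition chain_le A B (e : nat) : Prop :=
  forall k, chain k A B -> (k <= e)%N.

Lemma chain_subl k A' A B : A' `<=` A -> chain k A B -> chain k A' B.
Proof.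
case: k => // k A'A [C [hC AC CB ch]]; exists C; split=> //.
case: AC => AC nCA; split; first exact: subset_trans AC.
by move=> CA'; apply: nCA; apply: subset_trans CA' _.
Qed.

Lemma chain_subr k A B B' : B `<=` B' -> chain k A B -> chain k A B'.
Proof.
move=> BB'; elim: k A => // k IH A [C [hC AC CB ch]].
by exists C; split=> //; [apply: subset_trans BB'|apply: IH].
Qed.

Lemma chain_le_subl A A' B e : A `<=` A' -> chain_le A B e -> chain_le A' B e.
Proof. by move=> AA' h k /(chain_subl AA')/h. Qed.

Lemma chain_le_subr A B B' e : B `<=` B' -> chain_le A B' e -> chain_le A B e.
Proof. by move=> BB' h k /(chain_subr BB')/h. Qed.

Lemma chain1 A B : saturated B -> A `<` B -> chain 1 A B.
Proof. by move=> hB AB; exists B; split. Qed.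

Lemma chain_cat p q A B C : A `<=` B -> B `<=` C ->
  chain p A B -> chain q B C -> chain (p + q) A C.
Proof.
elim: p A => [|p IH] A AB BC; first by move=> _; apply: chain_subl.
move=> [A1 [hA1 AA1 A1B ch] chq]; exists A1; split=> //.
  exact: subset_trans BC.
exact: IH.
Qed.

Hypothesis Dring : subring D.
Hypothesis UD : U `<=` D.
Hypothesis U1 : U 1.
Hypothesis UM : forall u v, U u -> U v -> U (u * v).

Lemma sat_sub A : A `<=` sat A.
Proof. by move=> x Ax; exists 1; rewrite ?mul1r. Qed.

Lemma sat_saturated A : submodule D A -> saturated (sat A).
Proof.
move=> hA; split; first split.
- by apply: sat_sub; case: hA.
- move=> x y [u Uu Aux] [v Uv Avy]; exists (u * v); first exact: UM.
  have -> : u * v * (x + y) = v * (u * x) + u * (v * y) by ring.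
  by apply: (submoduleD hA); apply: (submoduleM hA) => //; apply: UD.
- move=> c x Dc [u Uu Aux]; exists u => //.
  by rewrite mulrCA; apply: (submoduleM hA).
- by move=> u x Uu [v Uv A_]; exists (v * u); [exact: UM|rewrite -mulrA].
Qed.

Lemma sat_submodule A : submodule D A -> submodule D (sat A).
Proof. by move=> /sat_saturated[]. Qed.

Lemma sat_min A V : saturated V -> A `<=` V -> sat A `<=` V.
Proof. by move=> [_ hV] AV x [u Uu /AV/hV]; apply. Qed.

Lemma sat_mono A B : A `<=` B -> sat A `<=` sat B.
Proof. by move=> AB x [u Uu /AB]; exists u. Qed.

Lemma saturatedI A B : saturated A -> saturated B -> saturated (A `&` B).
Proof.
move=> [hA sA] [hB sB]; split; first exact: submoduleI.
by move=> u x Uu [Aux Bux]; split; [exact: sA Aux|exact: sB Bux].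
Qed.

(* By the modular law, [A < A'] forces [A :&: B < A' :&: B] or
   [A + B < A' + B]. *)
Lemma chain_split_gen k A B C : saturated A -> saturated B -> saturated C ->
  B `<=` C -> chain k A C ->
  exists p q, [/\ (k <= p + q)%N, chain p (A `&` B) B &
                  chain q (sat (addm A B)) C].
Proof.
move=> hA hB hC BC; elim: k A hA => [|k IH] A hA; first by exists 0, 0.
move=> [A1 [hA1 AA1 A1C ch]].
have [p [q [kpq chp chq]]] := IH A1 hA1 ch.
have [AsubA1 nA1A] := AA1; have [[mA1 _] [mA sA] [mB _]] := And3 hA1 hA hB.
have [AB|nAB] := pselect (A1 `&` B `<=` A).
  exists p, q.+1; split; first by rewrite addnS.
    by apply: chain_subl chp => x [? ?]; split=> //; apply: AsubA1.
  exists (sat (addm A1 B)); split=> //.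
  - exact/sat_saturated/addm_submodule.
  - split; first by apply: sat_mono => _ [x /AsubA1 ? [y ? ->]];
      exists x => //; exists y.
    move=> h; apply: nA1A => x A1x.
    have [u Uu [y Ay [z Bz e]]] : sat (addm A B) x.
      by apply/h/sat_sub; apply: (addmSl (D := D)) mB _ A1x.
    apply: (sA u) => //; rewrite e; apply: (submoduleD mA) => //; apply: AB.
    split=> //; have -> : z = u * x - y by rewrite e addrC addKr.
    apply: (submoduleB Dring mA1); last exact: AsubA1.
    by apply: (submoduleM mA1) => //; apply: UD.
  - by apply: sat_min => //; apply: (addm_min (D := D)) => //; case: hC.
exists p.+1, q; split=> //.
  exists (A1 `&` B); split=> //; first exact: saturatedI.
  by split=> [x [? ?]|h]; [split=> //; apply: AsubA1|apply: nAB => x /h[]].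
apply: chain_subl chq; apply: sat_mono => _ [x /AsubA1 ? [y ? ->]].
by exists x => //; exists y.
Qed.

Lemma chain_split k A B C : saturated A -> saturated B -> saturated C ->
  A `<=` B -> B `<=` C -> chain k A C ->
  exists p q, [/\ (k <= p + q)%N, chain p A B & chain q B C].
Proof.
move=> hA hB hC AB BC ch.
have [p [q [kpq chp chq]]] := chain_split_gen hA hB hC BC ch.
exists p, q; split=> //; first by apply: chain_subl chp => x Ax; split=> //;
  apply: AB.
by apply: chain_subl chq => x Bx; apply/sat_sub/(addmSr (D := D)) => //;
  case: hA.
Qed.

Lemma chain_le_cat A B C e f : saturated A -> saturated B -> saturated C ->
  A `<=` B -> B `<=` C -> chain_le A B e -> chain_le B C f ->
  chain_le A C (e + f).
Proof.
move=> hA hB hC AB BC he hf k /(chain_split hA hB hC AB BC)[p [q [kpq]]].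
by move=> /he pe /hf qf; apply: leq_trans kpq _; apply: leq_add.
Qed.

(* When [D - U] is a prime ideal killing the generators modulo [O], each of them
   contributes a space of dimension at most one over the residue field. *)
Lemma chain_le_lincomb O zs : saturated O ->
  (forall d z, D d -> ~ U d -> z \in zs -> O (d * z)) ->
  chain_le O (sat (addm O (lincomb D zs))) (size zs).
Proof.
have hD := subring_submodule Dring.
elim: zs O => [|z zs IH] O hO kill.
  have h : sat (addm O (lincomb D [::])) `<=` O.
    apply: sat_min => //; apply: (addm_min (D := D)) => //; first by case: hO.
    by move=> _ ->; apply: submodule0 (proj1 hO).
  by move=> [|k] // [C [_ [_ nCO] CO _]]; case: nCO; apply: subset_trans h.
have [mO sO] := hO; pose O1 := sat (addm O (scalem z D)).
have mz := scalem_submodule z hD.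
have hO1 : saturated O1 by apply/sat_saturated/addm_submodule.
have OO1 : O `<=` O1 by move=> x Ox; apply/sat_sub/(addmSl (D := D)).
have mzs := lincomb_submodule zs hD.
pose W := sat (addm O (lincomb D (z :: zs))).
have hW : saturated W.
  exact/sat_saturated/addm_submodule/lincomb_submodule.
have O1W : O1 `<=` W.
  apply: sat_mono; apply: (addm_min (D := D)).
  - exact/addm_submodule/lincomb_submodule.
  - exact/(addmSl (D := D))/lincomb_submodule.
  - by move=> x zx; apply: (addmSr (D := D)) => //=; apply: (addmSl (D := D)).
apply: (chain_le_cat hO hO1 hW OO1 O1W (e := 1)); last first.
  apply: (chain_le_subr _ (IH O1 hO1 _)); last first.
    by move=> d y Dd nUd yzs; apply/OO1/kill => //; rewrite inE yzs orbT.
  apply: sat_min; first exact/sat_saturated/addm_submodule/mzs/(proj1 hO1).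
  have mO1 := proj1 hO1; apply: (addm_min (D := D)).
  - exact/sat_submodule/addm_submodule.
  - by move=> x Ox; apply/sat_sub/(addmSl (D := D)) => //; apply: OO1.
  - apply: (addm_min (D := D)); first exact/sat_submodule/addm_submodule.
      move=> x zx; apply/sat_sub/(addmSl (D := D)) => //; apply/sat_sub.
      exact: (addmSr (D := D)).
    by move=> x zx; apply/sat_sub/(addmSr (D := D)).
(* [O1 / O] has length at most one: an element of [C] outside [O] yields, up to [U] and modulo [O],
   some [d z]; here [d] is in [U], so [z] is in [C] and [C] is already [O1]. *)
case=> [|[|k]] //= [C [[mC sC] [OC nCO] CO1 [C' [_ [_ nC'C] C'O1 _]]]].
exfalso; apply: nC'C; apply: subset_trans C'O1 _.
have [x Cx nOx] : exists2 x, C x & ~ O x.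
  by apply: contrapT => h; apply: nCO => x Cx; apply: contrapT => nOx;
    apply: h; exists x.
have [u Uu [y Oy [_ [d Dd ->] e]]] := CO1 x Cx.
have Cdz : C (z * d).
  apply: (submoduleDl Dring mC (OC y Oy)); rewrite -e.
  by apply: (submoduleM mC) => //; apply: UD.
have Ud : U d.
  apply: contrapT => nUd; apply: nOx; apply: (sO u) => //; rewrite e.
  by apply: (submoduleD mO) => //; rewrite mulrC; apply: kill;
    rewrite ?inE ?eqxx.
apply: sat_min => //; apply: (addm_min (D := D)) => // _ [c Dc ->].
rewrite mulrC; apply: (submoduleM mC) => //.
by apply: (sC d) => //; rewrite mulrC.
Qed.

(* Choosing [z_1], [z_2], ... in [A] greedily outside the submodules already
   generated produces a strict chain. *)
Lemma chain_le_gens O A e : saturated O -> saturated A -> O `<=` A ->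
  chain_le O A e -> exists zs, [/\ (size zs <= e)%N, [set` zs] `<=` A &
                                   A `<=` sat (addm O (lincomb D zs))].
Proof.
have hD := subring_submodule Dring.
elim: e O => [|e IH] O hO hA OA le.
  exists [::]; split=> // x Ax; apply/sat_sub/(addmSl (D := D));
    first exact: lincomb_submodule.
  by apply: contrapT => nOx; have := le 1 (chain1 hA (conj OA (fun h =>
    nOx (h x Ax)))).
have [AO|nAO] := pselect (A `<=` O).
  exists [::]; split=> // x Ax; apply/sat_sub/(addmSl (D := D));
    last exact: AO.
  exact: lincomb_submodule.
have [z Az nOz] : exists2 x, A x & ~ O x.
  by apply: contrapT => h; apply: nAO => x Ax; apply: contrapT => nOx;
    apply: h; exists x.
have [mO _] := hO; have [mA _] := hA.
have mz := scalem_submodule z hD.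
pose O1 := sat (addm O (scalem z D)).
have hO1 : saturated O1 by apply/sat_saturated/addm_submodule.
have O1A : O1 `<=` A.
  apply: sat_min => //; apply: (addm_min (D := D)) => // _ [c Dc ->].
  by rewrite mulrC; apply: (submoduleM mA).
have le1 : chain_le O1 A e.
  move=> k ch; have /le : chain (1 + k) O A; last by [].
  apply: (chain_cat _ O1A _ ch); first by move=> x Ox;
    apply/sat_sub/(addmSl (D := D)).
  apply: chain1 => //; split; first by move=> x Ox;
    apply/sat_sub/(addmSl (D := D)).
  move=> h; apply/nOz/h/sat_sub/(addmSr (D := D)) => //.
  by exists 1; rewrite ?mulr1 //; case: Dring.
have [zs [sz zsA Agen]] := IH O1 hO1 hA O1A le1.
exists (z :: zs); split=> //.
  by move=> y /=; rewrite inE => /orP[/eqP->|/zsA].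
apply: subset_trans Agen _; apply: sat_min.
  exact/sat_saturated/addm_submodule/lincomb_submodule.
have mzs := lincomb_submodule zs hD.
have mzzs := lincomb_submodule (z :: zs) hD.
apply: (addm_min (D := D)); first exact/sat_submodule/addm_submodule.
  apply: sat_mono; apply: (addm_min (D := D)); first exact: addm_submodule.
    exact: (addmSl (D := D)).
  by move=> x zx; apply: (addmSr (D := D)) => //; apply: (addmSl (D := D)).
by move=> x zx; apply/sat_sub/(addmSr (D := D)) => //;
  apply: (addmSr (D := D)).
Qed.

End Chains.

(** * Noetherian rings of dimension at most one: lengths modulo a regular element *)

Section NoetherianRing.
Variable R : comPzRingType.
Hypothesis noethR : noetherian_ring R.
Implicit Types (I J M : set R).

Notation ideal := (submodule (setT : set R)).

Lemma ideal1 I x : ideal I -> I 1 -> I x.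
Proof. by move=> hI I1; rewrite -[x]mulr1; apply: (submoduleM hI). Qed.

Lemma ascending_leq (C : nat -> set R) i j :
  (forall k, C k `<=` C k.+1) -> (i <= j)%N -> C i `<=` C j.
Proof.
move=> asc /subnKC <-; elim: (j - i)%N => [|k IH]; first by rewrite addn0.
by rewrite addnS; apply: subset_trans (asc _).
Qed.

Lemma ascending_stable (C : nat -> set R) : (forall k, ideal (C k)) ->
  (forall k, C k `<=` C k.+1) -> exists k, C k.+1 `<=` C k.
Proof.
move=> hC asc; pose V : set R := [set x | exists k, C k x].
have hV : ideal V.
  split; first by exists 0; apply: submodule0 (hC 0).
    move=> x y [i Cx] [j Cy]; exists (maxn i j); apply: (submoduleD (hC _)).
      exact: ascending_leq asc (leq_maxl i j) _ Cx.
    exact: ascending_leq asc (leq_maxr i j) _ Cy.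
  by move=> c x _ [i Cx]; exists i; apply: (submoduleM (hC i)).
have [_ [s _ Vs]] := noethR hV (@subsetT _ V).
suff [k sk] : exists k, [set` s] `<=` C k.
  exists k => x Cx; have : V x by exists k.+1.
  by rewrite Vs; apply: span_min.
have : [set` s] `<=` V by rewrite Vs; apply: span_sub.
elim: s {Vs} => [|z s IH] sV; first by exists 0.
have [|i si] := IH; first by move=> x xs; apply: sV => /=; rewrite inE xs orbT.
have [j Cz] : V z by apply: sV; rewrite /= inE eqxx.
exists (maxn i j) => x /=; rewrite inE => /orP[/eqP->|/si].
  exact: ascending_leq asc (leq_maxr i j) _ Cz.
exact: ascending_leq asc (leq_maxl i j) _.
Qed.

(** Otherwise dependent choice would build a strictly ascending sequence of ideals starting at [I0],
    against [ascending_stable]. *)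
Lemma noetherian_maximal (F : set (set R)) I0 :
  (forall I, F I -> ideal I) -> F I0 ->
  exists I, [/\ F I, I0 `<=` I & forall J, F J -> I `<=` J -> J `<=` I].
Proof.
move=> hF FI0; apply: contrapT => nmax.
have next (I : {I | F I /\ I0 `<=` I}) :
  {J : {I | F I /\ I0 `<=` I} | sval I `<=` sval J /\ ~ sval J `<=` sval I}.
  case: I => I [FI I0I] /=; apply: cid; apply: contrapT => nJ.
  apply: nmax; exists I; split=> // J FJ IJ; apply: contrapT => nJI.
  have FJ' : F J /\ I0 `<=` J by split=> //; apply: subset_trans IJ.
  by apply: nJ; exists (exist _ J FJ').
pose C := fix C k : {I | F I /\ I0 `<=` I} :=
  if k is k'.+1 then sval (next (C k')) else exist _ I0 (conj FI0
    (@subset_refl _ I0)).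
have [k Ck] := @ascending_stable (fun k => sval (C k))
  (fun k => hF _ (proj1 (svalP (C k)))) (fun k => proj1 (svalP (next (C k)))).
exact: proj2 (svalP (next (C k))) Ck.
Qed.

Lemma exists_maxIdeal I : ideal I -> ~ I 1 ->
  exists m : maxIdeal R, I `<=` maxideal_set m.
Proof.
move=> hI nI1.
have [//|M [[hM nM1] IM Mmax]] :=
  @noetherian_maximal [set J | ideal J /\ ~ J 1] I (fun J => @proj1 _ _) _.
have maxM : maximal_ideal M.
  by split=> // B hB nB1 MB; apply/seteqP; split=> //; apply: Mmax.
by exists (MaxIdeal maxM).
Qed.

Lemma maxIdeal_prime (m : maxIdeal R) : prime_ideal (maxideal_set m).
Proof.
have [hm m1 _] := maxidealP m; split=> // x y mxy.
have [mx|nmx] := pselect (maxideal_set m x); first by left.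
right; apply: contrapT => nmy.
by have /maxcomplP := maxcompl_M (introT (maxcomplP m x) nmx) (introT
  (maxcomplP m y) nmy).
Qed.

(** The products of a power of [c] with an element outside [I] form a multiplicative set [S], which
    avoids [0] because [c] is regular. An ideal maximal among those disjoint from [S] is prime, lies
    in [I] and misses [c]. *)
Lemma prime_below_regular I c : prime_ideal I -> I c -> c \in nonzerodiv R ->
  exists p, [/\ prime_ideal p, p `<=` I & ~ p c].
Proof.
move=> [hI I1 Ipr] Ic /nonzerodivP creg.
pose S := [set x | exists k s, ~ I s /\ x = c ^+ k * s].
have S_mul x y : S x -> S y -> S (x * y).
  move=> [k [s [nIs ->]]] [l [t [nIt ->]]]; exists (k + l)%N, (s * t).
  by split; [case/Ipr|rewrite exprD; ring].
have nS0 : ~ S 0.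
  move=> [k [s [nIs e]]]; apply: nIs; suff -> : s = 0 by apply: submodule0 hI.
  by elim: k e => [|k IH]; rewrite ?mul1r // exprS -mulrA => /esym/creg/esym.
pose F := [set J | ideal J /\ forall x, J x -> ~ S x].
have F0 : F [set 0].
  split=> [|_ -> //]; split=> // [_ _ -> ->|d _ _ ->];
    rewrite ?addr0 ?mulr0 //.
have [//|p [[hp pS] _ pmax]] := @noetherian_maximal F [set 0] (fun J =>
  @proj1 _ _) _.
have meet x : ~ p x -> exists2 a, p a & exists r, S (a + x * r).
  move=> npx; apply: contrapT => nmeet; apply: npx.
  have hJ := addm_submodule hp (scalem_submodule x (subring_submodule
    (setT_subring R))).
  apply: (pmax _ _ (addmSl (scalem_submodule x (subring_submodule
    (setT_subring R))))).
    split=> // _ [a pa [_ [r _ ->] ->]] Sx; apply: nmeet; exists a => //.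
    by exists r.
  by apply: (addmSr hp); exists 1; rewrite ?mulr1.
exists p; split.
- split=> //; first by move/pS; apply; exists 0%N, 1; rewrite mulr1.
  move=> x y pxy; apply: contrapT =>
    /not_orP[/meet[a pa [r Sx]] /meet[b pb [t Sy]]].
  apply: pS (S_mul _ _ Sx Sy).
  have -> : (a + x * r) * (b + y * t) = (b + y * t) * a + x * r * b + r * t *
    (x * y).
    by ring.
  by do 2?[apply: (submoduleD hp)]; apply: (submoduleM hp).
- move=> x px; apply: contrapT => nIx; apply: (pS x px).
  by exists 0%N, x; rewrite mul1r.
- by move/pS; apply; exists 1%N, 1; rewrite mulr1.
Qed.

Hypothesis dimR : krull_dim_le R 1.

(** A prime strictly below [I], the prime [I], and a maximal ideal above a strictly larger [J] would
    form a chain of three primes. *)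
Lemma prime_regular_maximal I c : prime_ideal I -> I c -> c \in nonzerodiv R ->
  forall J, ideal J -> ~ J 1 -> I `<=` J -> J `<=` I.
Proof.
move=> hI Ic creg J hJ nJ1 IJ; apply: contrapT => nJI.
have [p [hp pI npc]] := prime_below_regular hI Ic creg.
have [m Jm] := exists_maxIdeal hJ nJ1.
case: dimR; exists (fun i => if i is i'.+1 then if i' is 0 then I else
  maxideal_set m else p).
split; first by case=> [|[|[|i]]] // _; apply: maxIdeal_prime.
case=> [|[|i]] // _; split=> //; first by move=> /(_ c Ic).
  exact: subset_trans Jm.
by move=> mI; apply: nJI; apply: subset_trans mI.
Qed.

(** For the multiplicative set reduced to [1], every ideal is saturated, and chains measure ordinary
    length. *)
Notation ichain := (chain (setT : set R) [set 1]).
Notation ichain_le := (chain_le (setT : set R) [set 1]).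
Notation isaturated := (saturated (setT : set R) [set 1]).

Let TR := setT_subring R.
Let hT := subring_submodule TR.

Lemma ideal_saturated I : ideal I -> isaturated I.
Proof. by move=> hI; split=> // u x ->; rewrite mul1r. Qed.

(** Every member [C] of the chain contains [I], so inside [I + x R] it is determined by the [r] with
    [r x] in [C]: strict inclusions survive the pullback. *)
Lemma chain_colon k I J x : ideal J -> I `<=` J ->
  ichain k J (addm I (scalem x setT)) -> ichain k [set r | J (r * x)] setT.
Proof.
elim: k J => // k IH J hJ IJ [C [[hC _] [JC nCJ] CB ch]].
exists [set r | C (r * x)]; split=> //.
- exact/ideal_saturated/colonX_submodule.
- split=> [r /JC //|h]; apply: nCJ => y Cy.
  have [i Ii [_ [r _ ->] e]] := CB y Cy.
  rewrite e; apply: (submoduleD hJ); first exact: IJ.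
  rewrite mulrC; apply: h; rewrite /= mulrC.
  by apply: (submoduleDl TR hC (JC _ (IJ _ Ii))); rewrite -e.
- exact: (IH C hC (subset_trans IJ JC) ch).
Qed.

Lemma chain_le_maximal I : ideal I ->
  (forall J, ideal J -> ~ J 1 -> I `<=` J -> J `<=` I) -> ichain_le I setT 1.
Proof.
move=> hI Imax [|[|k]] //= [C [[hC _] [IC nCI] _ [C' [_ [CC' nC'C] _ _]]]].
exfalso; apply: nCI; apply: Imax => // C1.
by apply: nC'C => x _; apply: ideal1.
Qed.

(* Noetherian induction: an ideal containing [c] and maximal among those with
   a quotient of infinite length is prime, hence maximal by the bound on the
   dimension. *)
Lemma finite_length_regular c : c \in nonzerodiv R ->
  exists e, ichain_le (scalem c setT) setT e.
Proof.
move=> creg; apply: contrapT => nfin.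
pose F := [set I : set R | [/\ ideal I, I c & ~ exists e, ichain_le I setT e]].
have F0 : F (scalem c setT).
  by split=> //; [exact: scalem_submodule|exists 1; rewrite ?mulr1].
have [|I [[hI Ic Inf] _ Imax]] := noetherian_maximal _ F0;
  first by move=> J [].
have fin J : ideal J -> I `<=` J -> ~ J `<=` I -> exists e, ichain_le J setT e.
  move=> hJ IJ nJI; apply: contrapT => Jinf; apply: nJI; apply: Imax => //.
  by split=> //; apply: IJ.
have Ipr : prime_ideal I.
  split=> // [I1|x y Ixy].
    apply: Inf; exists 0%N; case=> // k [C [_ [_ nCI] _ _]]; case: nCI => z _.
    exact: ideal1.
  apply: contrapT => /not_orP[nIx nIy].
  have hcol : ideal [set r | I (r * x)] by apply: colonX_submodule.
  have hx := scalem_submodule x hT; have hIx := addm_submodule hI hx.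
  have [|h|e he] := fin _ hcol.
  - by move=> r Ir /=; rewrite mulrC; apply: (submoduleM hI).
  - by apply: nIy; apply: h; rewrite /= mulrC.
  have [|h|f hf] := fin _ hIx; first exact: addmSl hx.
    by apply/nIx/h/(addmSr hI); exists 1; rewrite ?mulr1.
  (* [e] bounds the length of [(I + x R) / I], which is isomorphic to [R / (I : x)], and [f] that of
     [R / (I + x R)]. *)
  apply: Inf; exists (e + f)%N.
  apply: (chain_le_cat TR _ _ _ (B := addm I (scalem x setT))) => //;
    do ?exact: ideal_saturated; first by move=> _ _ -> ->; rewrite mulr1.
    exact: addmSl hx.
  by move=> k /(chain_colon hI (@subset_refl _ I))/he.
by apply: Inf; exists 1%N; apply: chain_le_maximal (prime_regular_maximal Ipr
  Ic creg).
Qed.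

(** Multiplication by the regular [c] is injective, and an ideal [C] inside [c B] is [c] times the
    ideal of all [x] with [c x] in [C]. *)
Lemma chain_scale k c A B : c \in nonzerodiv R -> ideal A ->
  ichain k A B <-> ichain k (scalem c A) (scalem c B).
Proof.
move=> /nonzerodivP creg; have cinj x y : c * x = c * y -> x = y.
  by move=> e; apply/subr0_eq/creg; rewrite mulrBr e subrr.
have sub A' B' : A' `<=` B' <-> scalem c A' `<=` scalem c B'.
  split=> [h _ [x Ax ->]|h x Ax]; first by exists x => //; apply: h.
  by have [|y By /cinj ->] := h (c * x); first by exists x.
elim: k A => // k IH A hA; split=> -[C [[hC _] [AC nCA] CB ch]].
  exists (scalem c C); split; first exact/ideal_saturated/scalem_submodule.
  - by split; rewrite -sub.
  - by rewrite -sub.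
  - by rewrite -IH.
have eC : C = scalem c [set x | C (c * x)].
  apply/seteqP; split=> [y Cy|_ [x Cx ->] //].
  by have [x _ e] := CB y Cy; exists x => //=; rewrite -e.
have hC' : ideal [set x | C (c * x)].
  rewrite (_ : mkset _ = [set x | C (x * c)]); first exact: colonX_submodule.
  by apply/seteqP; split=> x /=; rewrite mulrC.
exists [set x | C (c * x)]; split; first exact: ideal_saturated.
- by split; rewrite sub -eC.
- by rewrite sub -eC.
- by rewrite IH // -eC.
Qed.

(* Refine [R > I > c I] and [R > c R > c I], and cancel the lengths of
   [R / I] and of the isomorphic [c R / c I]. *)
Lemma chain_le_scale_regular c g e I : c \in nonzerodiv R ->
  g \in nonzerodiv R -> ichain_le (scalem c setT) setT e -> ideal I -> I g ->
  ichain_le (scalem c I) I e.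
Proof.
move=> creg greg le_e hI Ig k chk.
have [f0 le_f0] := finite_length_regular greg.
(* The exact length [f] of [R / I], finite because [I] contains the regular [g]; only a finite
   length can be cancelled. *)
have [f le_f [chf max_f]] : exists2 f,
  (f <= f0)%N & ichain f I setT /\ ichain_le I setT f.
  have le_f : ichain_le I setT f0.
    apply: chain_le_subl le_f0 => _ [x _ ->]; rewrite mulrC.
    exact: (submoduleM hI).
  have ex : exists f, `[< ichain f I setT >] by exists 0%N; apply/asboolP.
  have ub f : `[< ichain f I setT >] -> (f <= f0)%N by move=> /asboolP/le_f.
  case: (ex_maxnP ex ub) => f /asboolP chf fmax; exists f; first exact: le_f.
  by split=> // l /asboolP/fmax.
have cI : scalem c I `<=` I by move=> _ [x Ix ->]; apply: (submoduleM hI).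
have cIR : scalem c I `<=` scalem c setT by move=> _ [x _ ->]; exists x.
have hcI := scalem_submodule c hI; have hcR := scalem_submodule c hT.
have ch : ichain (k + f) (scalem c I) setT by apply: chain_cat chk chf.
have [|||p [q [kf chp chq]]] := chain_split TR _ _ _ (ideal_saturated hcI)
  (ideal_saturated hcR) (ideal_saturated hT) cIR (@subsetT _ _) ch => //.
- by move=> _ _ -> ->; rewrite mulr1.
have := max_f _ (proj2 (@chain_scale p c I setT creg hI) chp);
  have := le_e _ chq; lia.
Qed.

(** [e] depends on [c] alone, so it can be fixed before the power of [a] that [I] represents, and
    even serve as the exponent. *)
Lemma gens_mod_regular c : c \in nonzerodiv R -> exists e, forall g I,
  g \in nonzerodiv R -> ideal I -> I g ->
  exists zs, [/\ (size zs <= e)%N, [set` zs] `<=` I &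
    I `<=` addm (scalem c I) (lincomb setT zs)].
Proof.
move=> creg; have [e le_e] := finite_length_regular creg;
  exists e => g I greg hI Ig.
have cI : scalem c I `<=` I by move=> _ [x Ix ->]; apply: (submoduleM hI).
have [|||zs [sz zsI Igen]] := chain_le_gens TR _ _ _
  (ideal_saturated (scalem_submodule c hI)) (ideal_saturated hI) cI
  (chain_le_scale_regular creg greg le_e hI Ig) => //.
  by move=> _ _ -> ->; rewrite mulr1.
exists zs; split=> // x /Igen[_ ->]; by rewrite mul1r.
Qed.

End NoetherianRing.

(** * Reductions by generic elements, and Nakayama's lemma *)

Section GenericReduction.
Variables (T : comPzRingType) (D U : set T).
Implicit Types (A B C M N V O P W : set T) (zs : seq T).

Hypothesis UD : U `<=` D.
Hypothesis U1 : U 1.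
Hypothesis UM : forall u v, U u -> U v -> U (u * v).


Notation saturated := (saturated D U).
Notation sat := (sat U).
Notation chain := (chain D U).
Notation chain_le := (chain_le D U).

Let sub_sat A : A `<=` sat A. Proof. exact: sat_sub. Qed.

Section EakinSathaye.
Variables (Y : set T) (l : nat -> T).
Hypothesis lY : forall j, span D Y (l j).
(** Genericity of the sequence [l]. For polynomial expressions in sample points it follows by
    interpolation, since infinitely many values determine the coefficients. *)
Hypothesis l_generic : forall V h, saturated V ->
  (forall b, exists2 j, (b <= j)%N & V (l j * h)) ->
  forall y, Y y -> V (y * h).

(** The product [Y^n M]; keeping [M] variable lets the induction pass from [M] to [l_i M]. *)
Definition expand n M : set T := iter n (prodm D Y) M.

Lemma expand_submodule n M : submodule D M -> submodule D (expand n M).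
Proof. by case: n => [|n] //= _; apply: prodm_submodule. Qed.

Lemma expand_linear n M j h : expand n M h -> expand n.+1 M (l j * h).
Proof.
move=> Mh /=.
have hV : submodule D [set x | prodm D Y (expand n M) (x * h)].
  exact/colonX_submodule/prodm_submodule.
apply: (span_min hV _ (lY j)).
by move=> y Yy; apply: prodm_mul.
Qed.

Lemma scale_expand z n M : submodule D M ->
  scalem z (expand n M) = expand n (scalem z M).
Proof.
move=> hM; elim: n => //= n IH; apply/seteqP; split.
  move=> _ [h Mh ->]; rewrite mulrC.
  have hV : submodule D [set x | prodm D Y (expand n (scalem z M)) (x * z)].
    exact/colonX_submodule/prodm_submodule.
  apply: (prodm_min hV _ Mh) => /=.
  move=> y g Yy Mg /=; rewrite -mulrA; apply: prodm_mul => //.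
  by rewrite -/(expand n _) -IH mulrC; exists g.
apply: prodm_min; first exact/scalem_submodule/prodm_submodule.
move=> y g Yy; rewrite -/(expand n _) -IH => -[h Mh ->].
by rewrite mulrCA; exists (y * h) => //; apply: prodm_mul.
Qed.

(** The premise is the conclusion of [eakin_sathaye] for [l_i M]. For positive [n] it bounds
    [l_i Y^n M] by [O + l_j l_i Y^(n-1) M], and [l_i], lying in the span of [Y], is absorbed into
    [Y^n M]. *)
Lemma expand_absorb n M O i : submodule D M -> submodule D O ->
  (if n is n'.+1 then
     exists b, forall j, (b <= j)%N -> expand n (scalem (l i) M)
       `<=` sat (addm O (scalem (l j) (expand n' (scalem (l i) M))))
   else scalem (l i) M `<=` O) ->
  exists b, forall j, (b <= j)%N ->
    scalem (l i) (expand n M) `<=` sat (addm O (scalem (l j) (expand n M))).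
Proof.
move=> hM hO; case: n => [MO|n [b hb]].
  by exists 0%N => j _ x /MO Ox;
    apply/sub_sat/(addmSl (scalem_submodule _ hM)).
exists b => j /hb; rewrite -!scale_expand // => h; apply: subset_trans h _.
apply: sat_mono => _ [x Ox [_ [_ [h Eh ->] ->] ->]]; exists x => //.
by eexists; [exists (l i * h); [exact: expand_linear|reflexivity]|].
Qed.

(* If [l_i] fails infinitely often, induction applied to [l_i M] shows that
   [V i <= V j] for [j] large, where [V i] is the image of [l_i]; then a
   maximal [V i] contains infinitely many [V j], hence everything. *)
Lemma eakin_sathaye n M O : submodule D M -> saturated O ->
  chain_le O (sat (addm O (expand n M))) n ->
  if n is n'.+1 then
    exists b, forall j, (b <= j)%N ->
      expand n M `<=` sat (addm O (scalem (l j) (expand n' M)))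
  else M `<=` O.
Proof.
elim: n M O => [|n IH] M O hM hO le_n.
  have hW : saturated (sat (addm O M)).
    by apply: sat_saturated => //; apply: addm_submodule => //; case: hO.
  have OW : O `<=` sat (addm O M) by move=> x Ox; apply/sub_sat/(addmSl hM).
  apply: contrapT => nMO.
  have : chain 1 O (sat (addm O M)).
    apply: chain1 => //; split=> // h; apply: nMO => x Mx.
    by apply/h/sub_sat/(addmSr (proj1 hO)).
  by move/le_n.
have mO := proj1 hO.
pose V j := sat (addm O (scalem (l j) (expand n M))).
have hE := expand_submodule n hM; have hE1 := expand_submodule n.+1 hM.
have hV j : saturated (V j).
  exact/sat_saturated/addm_submodule/scalem_submodule.
have OV j : O `<=` V j.
  by move=> x Ox; apply/sub_sat/(addmSl (scalem_submodule _ hE)).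
pose W := sat (addm O (expand n.+1 M)).
have hW : saturated W by apply/sat_saturated/addm_submodule.
have VW j : V j `<=` W.
  apply/sat_mono/(addm_min (addm_submodule mO hE1)); first exact: addmSl hE1.
  by move=> _ [h Eh ->]; apply: (addmSr mO); apply: expand_linear.
have WV j : expand n.+1 M `<=` V j -> W `<=` V j.
  move=> EV; apply: (sat_min (hV j));
    exact: addm_min (proj1 (hV j)) (@OV j) EV.
pose bad j := ~ expand n.+1 M `<=` V j.
apply: contrapT => nb.
have infbad b : exists2 j, (b <= j)%N & bad j.
  apply: contrapT => nj; apply: nb; exists b => j bj.
  by apply: contrapT => badj; apply: nj; exists j.
have properVW j : bad j -> V j `<` W.
  move=> badj; split=> // WVj; apply: badj => x Ex.
  by apply/WVj/sub_sat/(addmSr mO).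
have absorb i : bad i -> exists b, forall j, (b <= j)%N -> V i `<=` V j.
  move=> badi; pose M' := scalem (l i) M.
  have hM' : submodule D M' by apply: scalem_submodule.
  (* A chain up to the proper submodule [V i] extends by [W], so the bound drops from [n + 1] to
     [n], as the induction requires. *)
  have le' : chain_le O (sat (addm O (expand n M'))) n.
    rewrite /M' -scale_expand // -/(V i) => k ch.
    have := chain_cat (OV i) (@VW i) ch (chain1 hW (properVW i badi)).
    by move/le_n; rewrite addn1.
  have [b hb] := expand_absorb hM mO (IH M' O hM' hO le').
  exists b => j bj; apply: sat_min (hV j) _.
  exact: addm_min (proj1 (hV j)) (@OV j) (hb j bj).
(* [V i] is maximal in length: [k] is the largest length of a chain from [O] to a failing [V i], so
   a strict inclusion of [V i] in another failing [V j] would give [k + 1]. *)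
have [k [i badi chi] kmax] : exists2 k, exists2 i, bad i & chain k O (V i) &
    forall j, bad j -> chain_le O (V j) k.
  have ex : exists k, `[< exists2 i, bad i & chain k O (V i) >].
    by exists 0%N; apply/asboolP; have [i _ badi] := infbad 0%N; exists i.
  have ub k : `[< exists2 i, bad i & chain k O (V i) >] -> (k <= n.+1)%N.
    by move=> /asboolP[i badi /(chain_subr (@VW i))/le_n].
  case: (ex_maxnP ex ub) => k /asboolP chk kmax; exists k => // j badj k' ch.
  by apply: kmax; apply/asboolP; exists j.
have [b hb] := absorb i badi.
apply: (badi); apply: prodm_min (proj1 (hV i)) _ => y h Yy Eh.
apply: (l_generic (hV i)) Yy => b'.
have [j bj badj] := infbad (maxn b b'); move: bj;
  rewrite geq_max => /andP[bj b'j].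
exists j => //; suff VjVi : V j `<=` V i.
  by apply/VjVi/sub_sat/(addmSr mO); exists h.
apply: contrapT => nVjVi.
have := chain_cat (OV i) (hb j bj) chi (chain1 (hV j) (conj (hb j bj) nVjVi)).
by move/(kmax j badj); rewrite addn1 ltnn.
Qed.

End EakinSathaye.

Lemma sat_bound W zs : submodule D W -> [set` zs] `<=` sat W ->
  exists2 u, U u & forall z, z \in zs -> W (u * z).
Proof.
move=> hW; elim: zs => [|z zs IH] zsW; first by exists 1.
have [|u Uu hu] := IH; first by move=> x xzs; apply: zsW => /=;
  rewrite inE xzs orbT.
have [v Uv Wv] : sat W z by apply: zsW; rewrite /= inE eqxx.
exists (u * v); first exact: UM.
move=> x; rewrite inE => /orP[/eqP->|/hu Wx]; first rewrite -mulrA.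
  by apply: (submoduleM hW) => //; apply: UD.
by rewrite -mulrA mulrCA; apply: (submoduleM hW) => //; apply: UD.
Qed.

(** Generators are eliminated one at a time: [u - p] is again in [U], so the relation for [z] can be
    solved for [(u - p) z] and substituted into the relations for the others. *)
Lemma nakayama P W zs : submodule D P -> P `<=` D ->
  (forall u p, U u -> P p -> U (u - p)) -> submodule D W ->
  [set` zs] `<=` sat (addm W (lincomb P zs)) -> [set` zs] `<=` sat W.
Proof.
move=> hP PD UP hW; elim: zs => [|z zs IH] gen //.
have hPzs := lincomb_submodule zs hP.
have [u Uu [w Ww [_ [_ [p Pp ->] [r rP ->]] e]]] : sat (addm W (lincomb P (z
  :: zs))) z.
  by apply: gen; rewrite /= inE eqxx.
have Uv : U (u - p) by apply: UP.
have ez : (u - p) * z = w + r by rewrite mulrBl e; ring.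
have zsW : [set` zs] `<=` sat W.
  apply: IH => y yzs.
  have [u' Uu' [w' Ww' [_ [_ [p' Pp' ->] [r' rP' ->]] e']]] :
      sat (addm W (lincomb P (z :: zs))) y.
    by apply: gen; rewrite /= inE yzs orbT.
  exists ((u - p) * u'); first exact: UM.
  have -> : (u - p) * u' * y = ((u - p) * w' + p' * w) + (p' * r + (u - p) *
    r').
    rewrite -mulrA e'; have -> : (u - p) * (w' + (z * p' + r'))
      = (u - p) * w' + p' * ((u - p) * z) + (u - p) * r' by ring.
    by rewrite ez; ring.
  exists ((u - p) * w' + p' * w).
    by apply: (submoduleD hW); apply: (submoduleM hW) => //;
      [apply: UD|apply: PD].
  exists (p' * r + (u - p) * r') => //.
  by apply: (submoduleD hPzs); apply: (submoduleM hPzs) => //;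
    [apply: PD|apply: UD].
have hsW := sat_saturated UD U1 UM hW.
move=> y; rewrite /= inE => /orP[/eqP->|/zsW //].
apply: (proj2 hsW _ _ Uv); rewrite ez; apply: (submoduleD (proj1 hsW)).
  exact: sub_sat.
apply: (lincomb_min (proj1 hsW) _ rP) => c x Pc xzs.
by apply: (submoduleM (proj1 hsW)); [exact: PD|exact: zsW].
Qed.

End GenericReduction.

(** * Recovering the coefficients of a polynomial from its values *)

Section PolynomialInterpolation.
Variables (T : comNzRingType) (D U : set T) (t : nat -> T).
Hypothesis Dring : subring D.
Hypothesis Dt : forall j, D (t j).
Hypothesis Ut : forall i j, (i < j)%N -> U (t j - t i).

(** Induction on the size: dividing [p - p(t_j0)] by [X - t_j0] gives a quotient [q] whose values at
    infinitely many later points are again in [V], because [t_j - t_j0] is in [U] and [V] is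
    saturated. *)
Lemma coef_of_values (V : set T) (p : {poly T}) : saturated D U V ->
  (forall b, exists2 j, (b <= j)%N & V p.[t j]) -> forall i, V p`_i.
Proof.
move=> [hV sV]; have [n] := ubnP (size p); elim: n p => // n IH p sp inf i.
have [j0 _ Vj0] := inf 0%N; pose c := p.[t j0].
have /factor_theorem[q e] : root (p - c%:P) (t j0).
  by rewrite /root hornerD hornerN hornerC subrr.
have ep : p = q * ('X - (t j0)%:P) + c%:P by rewrite -e subrK.
have [q0|q0] := eqVneq q 0.
  rewrite ep q0 mul0r add0r coefC; case: eqP => _ //; exact: submodule0 hV.
have sq : (size q < n)%N.
  have := size_Mmonic q0 (monicXsubC (t j0));
    rewrite -e size_XsubC addn2 /= => sz.
  have := size_polyD p (- c%:P); rewrite sz size_polyN size_polyC.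
  rewrite leq_max => /orP[sqp|]; first exact: leq_trans sqp sp.
  by move: q0; rewrite -size_poly_gt0; case: (size q) (c != 0) => [|k] [].
have Vq : forall i, V q`_i.
  apply: IH sq _ => b; have [j bj Vj] := inf (maxn b j0.+1).
  move: bj; rewrite geq_max => /andP[bj j0j]; exists j => //.
  apply: (sV _ _ (Ut j0j)); have -> : (t j - t j0) * q.[t j] = p.[t j] - c.
    by rewrite {1}ep hornerD hornerM hornerXsubC hornerC addrK mulrC.
  exact: (submoduleB Dring hV).
rewrite ep coefD mulrBr coefB coefMX coefMC coefC.
apply: (submoduleD hV); last by case: eqP => _ //; exact: submodule0 hV.
apply: (submoduleB Dring hV); first by case: eqP => _ //; exact: submodule0 hV.
by rewrite mulrC; apply: (submoduleM hV).
Qed.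

End PolynomialInterpolation.

(** * Modules over [B[X]] and the passage to the prime [m[X]] *)

Section PolynomialModules.
Variables (Q : comNzRingType) (B : set Q).
Hypothesis Bring : subring B.
Implicit Types (A M : set Q).

Definition polyset A : set {poly Q} := [set p | forall i, A p`_i].

Notation D := (polyset B).

Let hB := subring_submodule Bring.

Lemma submodule_sum A I (r : seq I) (P : pred I) (F : I -> Q) :
  submodule B A -> (forall i, P i -> A (F i)) -> A (\sum_(i <- r | P i) F i).
Proof.
move=> hA hF; apply: (big_ind A) => //; first exact: submodule0 hA.
by move=> x y Ax Ay; apply: (submoduleD hA).
Qed.

Lemma polyset_submodule A : submodule B A -> submodule D (polyset A).
Proof.
move=> hA; split=> [i|p q Ap Aq i|c p Bc Ap i].
- by rewrite coef0; apply: submodule0 hA.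
- by rewrite coefD; apply: (submoduleD hA).
- by rewrite coefM; apply: submodule_sum => // j _; apply: (submoduleM hA).
Qed.

Lemma polysetC A c : submodule B A -> A c -> polyset A c%:P.
Proof.
by move=> hA Ac i; rewrite coefC; case: eqP => _ //; apply: submodule0 hA.
Qed.

Lemma polysetXn n : D 'X^n.
Proof.
move=> i; rewrite coefXn; case: eqP => _; first exact: subring1.
exact: subring0.
Qed.

Lemma polyset_subring : subring D.
Proof.
split=> [i|p q Bp Bq i|p q Bp Bq].
- by rewrite coef1; case: eqP => _; [apply: subring1|apply: subring0].
- by rewrite coefB; apply: subringB.
- exact: (submoduleM (polyset_submodule hB)).
Qed.

Let Dring := polyset_subring.
Let hD := subring_submodule Dring.

Notation const A := (@polyC Q @` A).

Lemma span_const_sub A : submodule B A -> span D (const A) `<=` polyset A.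
Proof.
move=> hA; apply: span_min; first exact: polyset_submodule.
by move=> _ [c Ac <-]; apply: polysetC.
Qed.

Lemma polyC_preimage_submodule (V : set {poly Q}) :
  submodule D V -> submodule B [set c | V c%:P].
Proof.
move=> hV; split=> [|x y Vx Vy|c x Bc Vx] /=.
- by rewrite polyC0; apply: submodule0 hV.
- by rewrite polyCD; apply: (submoduleD hV).
- by rewrite polyCM; apply: (submoduleM hV) => //; apply: polysetC.
Qed.

(** With the constants of [a] as [Y], the abstract reduction result speaks of the powers of [a]. *)
Lemma expand_const a n : submodule B a ->
  expand D (const a) n D = span D (const (powm B a n)).
Proof.
move=> ha; elim: n => [|n IH].
  apply/seteqP; split=> [p Dp|]; last exact: span_const_sub.
  rewrite -[p]mulr1; apply: (submoduleM (span_submodule _ _) Dp).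
  by apply: span_sub; exists 1; rewrite ?polyC1 //; apply: subring1.
rewrite /expand /= -/(expand _ _ n _) IH; apply/seteqP; split.
  apply: prodm_min; first exact: span_submodule.
  move=> _ p [y ay <-] hp; rewrite mulrC.
  have hV : submodule D [set p | span D (const (powm B a n.+1)) (p * y%:P)].
    exact/colonX_submodule/span_submodule.
  apply: (span_min hV _ hp) => _ [c ac <-] /=; rewrite -polyCM.
  by apply: span_sub; exists (c * y) => //; apply: prodm_mul.
apply: span_min; first exact: prodm_submodule.
move=> _ [c ac <-].
have hV := polyC_preimage_submodule (prodm_submodule D (const a) (span D
  (const (powm B a n)))).
apply: (prodm_min hV _ ac) => x y ax ay /=; rewrite polyCM mulrC.
by apply: prodm_mul; [exists y|apply: span_sub; exists x].
Qed.

Section PrimeIdeal.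
Variable m : set Q.
Hypothesis hm : submodule B m.
Hypothesis mB : m `<=` B.
Hypothesis m1 : ~ m 1.
Hypothesis mprime : forall x y, B x -> B y -> m (x * y) -> m x \/ m y.

(** The complement of [m[X]] in [B[X]]. The residue field of this prime contains the indeterminate
    [X], so it is infinite whatever [B / m] is. *)
Definition polycompl : set {poly Q} := D `\` polyset m.

Notation U := polycompl.

Lemma polycompl_sub : U `<=` D. Proof. by move=> p []. Qed.

Lemma polycompl1 : U 1.
Proof. by split=> [|/(_ 0%N)]; [apply: subring1|rewrite coef1]. Qed.

Lemma polycomplC c : B c -> ~ m c -> U c%:P.
Proof. by move=> Bc nmc; split=> [|/(_ 0%N)];
  [apply: polysetC|rewrite coefC]. Qed.

Lemma polycomplB u p : U u -> polyset m p -> U (u - p).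
Proof.
move=> [Du nmu] mp; split.
  by apply: (subringB Dring Du) => i; apply: mB.
move=> mup; apply: nmu => i; rewrite -(subrK p u) coefD.
by apply: (submoduleD hm).
Qed.

Lemma first_coef_notin p : U p -> exists i, [/\ ~ m p`_i & forall j,
  (j < i)%N -> m p`_j].
Proof.
move=> [_ nmp]; have ex : exists i, `[< ~ m p`_i >].
  by apply: contrapT => h; apply: nmp => i; apply: contrapT => nm; apply: h;
    exists i; apply/asboolP.
case: (ex_minnP ex) => i /asboolP nmi imin; exists i; split=> // j ji.
by apply: contrapT => nmj; have := imin j (introT (asboolP _) nmj); lia.
Qed.

(** Gauss's lemma: if [i] and [j] are the first indices where the coefficients of [u] and [v] leave
    [m], then in the coefficient of index [i + j] only the term [u_i v_j] is outside [m]. *)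
Lemma polycomplM u v : U u -> U v -> U (u * v).
Proof.
move=> Uu Uv; have [Du _] := Uu; have [Dv _] := Uv; split;
  first exact: subringM Du Dv.
have [i [nmi imin]] := first_coef_notin Uu;
  have [j [nmj jmin]] := first_coef_notin Uv.
move=> /(_ (i + j)%N); rewrite coefM.
have ilt : (i < (i + j).+1)%N by lia.
rewrite (bigD1 (Ordinal ilt)) //= addKn addrC.
move=> muv; have /mprime[] // : m (u`_i * v`_j).
apply: (submoduleDl Bring hm) muv; apply: (submodule_sum _ hm) => k /negP ki.
have [lt|gt|eq] := ltngtP k i; last by case: ki; apply/eqP/val_inj.
  by rewrite mulrC; apply: (submoduleM hm) => //; apply: imin.
by apply: (submoduleM hm) => //; apply: jmin; have := ltn_ord k; lia.
Qed.

Lemma polycomplX i j : (i < j)%N -> U ('X^(j.+1) - 'X^(i.+1)).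
Proof.
move=> ij; split; first by apply: (subringB Dring); apply: polysetXn.
move/(_ j.+1); rewrite coefB !coefXn eqxx eqSS.
by case: eqP => [e|_]; [move: ij; rewrite e ltnn|rewrite subr0].
Qed.

(* For [ys = [:: w, y_1, ..., y_r]] this is [w + y_1 t + ... + y_r t^r], with
   [t = X^(j+1)]; a unit [w] as constant coefficient makes it regular. *)
Definition generic_form (ys : seq Q) (j : nat) : {poly Q} :=
  (Poly (map polyC ys) : {poly {poly Q}}).['X^(j.+1)].

Lemma generic_form_cons y ys j :
  generic_form (y :: ys) j = generic_form ys j * 'X^(j.+1) + y%:P.
Proof. by rewrite /generic_form /= horner_cons. Qed.

Lemma generic_form_span a ys j : [set` ys] `<=` a ->
  span D (const a) (generic_form ys j).
Proof.
elim: ys => [|y ys IH] ysa.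
  by rewrite /generic_form /= horner0; apply: submodule0 (span_submodule _ _).
rewrite generic_form_cons mulrC; apply: (submoduleD (span_submodule _ _)).
  apply: (submoduleM (span_submodule _ _)); first exact: polysetXn.
  by apply: IH => x xys; apply: ysa; rewrite /= inE xys orbT.
by apply: span_sub; exists y => //; apply: ysa; rewrite /= inE eqxx.
Qed.

(** The constant coefficient of the form is the unit [w], so the coefficients of [p - q] vanish one
    after the other. *)
Lemma generic_form_reg w w' ys j (p q : {poly Q}) : w * w' = 1 ->
  generic_form (w :: ys) j * p = generic_form (w :: ys) j * q -> p = q.
Proof.
move=> ww' e; apply/subr0_eq; set r := p - q.
have {e} : r * generic_form (w :: ys) j = 0 by rewrite mulrC mulrBr e subrr.
(* The exponent [j + 1] matters here: [X^(j+1)] has no constant term, even for [j = 0]. *)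
set f := generic_form _ _ => rf0; have f0 : f`_0 = w.
  by rewrite /f generic_form_cons coefD coefMXn /= add0r coefC.
apply/polyP => n; rewrite coef0; elim/ltn_ind: n => n IH.
have : (r * f)`_n = 0 by rewrite rf0 coef0.
rewrite coefM big_ord_recr /= subnn f0 big1 => [|k _];
  last by rewrite IH ?mul0r.
by rewrite add0r => /(congr1 ( *%R^~ w')); rewrite -mulrA ww' mulr1 mul0r.
Qed.

(** [generic_form ys j * h] is the value at [X^(j+1)] of the polynomial with coefficients [y_k h],
    and interpolation recovers these. *)
Lemma generic_form_generic a ys : a = span B [set` ys] ->
  forall V h, saturated D U V ->
  (forall b, exists2 j, (b <= j)%N & V (generic_form ys j * h)) ->
  forall y, const a y -> V (y * h).
Proof.
move=> -> V h hV inf _ [y ay <-].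
have hV' := polyC_preimage_submodule (colonX_submodule h (proj1 hV)).
apply: (span_min hV' _ ay) => x /= xys.
pose p : {poly {poly Q}} := Poly (map polyC ys) * h%:P.
have [k kys <-] := nthP 0 xys.
have -> : (ys`_k)%:P * h = p`_k by rewrite /p coefMC coef_Poly (nth_map 0).
apply: (coef_of_values Dring _ _ hV (t := fun j => 'X^(j.+1))).
- by move=> j; apply: polysetXn.
- exact: polycomplX.
- by move=> b; have [j bj Vj] := inf b; exists j; rewrite ?hornerM ?hornerC.
Qed.

Lemma lincomb_const (C : set Q) zs x : submodule B C ->
  lincomb C zs x -> lincomb (polyset C) (map polyC zs) x%:P.
Proof.
move=> hC hx.
have hV := polyC_preimage_submodule (lincomb_submodule (map polyC zs)
  (polyset_submodule hC)).
apply: (lincomb_min hV _ hx) => c z Cc zzs /=; rewrite polyCM.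
apply: (lincomb_mem (polyset_submodule hC)); first exact: polysetC.
exact: map_f.
Qed.

Let UD := polycompl_sub.
Let U1 := polycompl1.
Let UM := polycomplM.

(** Modulo [O], the saturation of [m[X] a^(n+1)], the [zs] generate [a^(n+1)] locally, so its length
    is at most [n + 1] and [eakin_sathaye] applies; Nakayama's lemma then removes [O]. *)
Lemma local_reduction (a : set Q) (ys gs zs : seq Q) (w w' : Q) (n : nat) :
  a = span B [set` ys] -> a w -> w * w' = 1 ->
  powm B a n.+1 = span B [set` gs] ->
  [set` zs] `<=` powm B a n.+1 -> (size zs <= n.+1)%N ->
  (forall x, powm B a n.+1 x -> exists s, [/\ B s, ~ m s &
     addm (lincomb m gs) (lincomb B zs) (s * x)]) ->
  exists s, [/\ B s, ~ m s &
    prodm B a (colon (powm B a n) (powm B a n.+1)) s].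
Proof.
move=> ea aw ww' eA zsA szs gen.
have ha : submodule B a by rewrite ea; apply: span_submodule.
pose A k := powm B a k; have hA k : submodule B (A k) by apply: powm_submodule.
pose P := polyset m; have hP : submodule D P by apply: polyset_submodule.
pose l := generic_form (w :: ys).
(* Prepending [w] does not change the span [a] but makes the constant coefficient of each form a
   unit. *)
have ysa : [set` w :: ys] `<=` a.
  by move=> y /=; rewrite inE => /orP[/eqP-> //|yys]; rewrite ea;
    apply: span_sub.
have ea' : a = span B [set` w :: ys].
  apply/seteqP; split; last exact: span_min.
  by rewrite {1}ea; apply: span_mono => y /=; rewrite inE orbC => ->.
have lY j : span D (const a) (l j) by apply: generic_form_span.
have l_gen := generic_form_generic ea'.
have hE k := expand_const k ha.
pose gsP := map polyC gs; pose zsP := map polyC zs.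
have hPgs := lincomb_submodule gsP hP.
pose O := sat U (lincomb P gsP).
have hO : saturated D U O by apply: sat_saturated.
have mO := proj1 hO; have subO : lincomb P gsP `<=` O by apply: sat_sub.
have kill d c : P d -> A n.+1 c -> O (d * c%:P).
  move=> Pd; rewrite /A eA => hc.
  have hV : submodule B [set c | O (d * c%:P)].
    have := polyC_preimage_submodule (colonX_submodule d mO).
    by rewrite (_ : mkset _ = [set c | O (d * c%:P)]) //; apply/seteqP;
      split=> z /=; rewrite mulrC.
  apply: (span_min hV _ hc) => g gg; apply/subO/(lincomb_mem hP Pd).
  exact: map_f.
have le_n : chain_le D U O (sat U (addm O (expand D (const a) n.+1 D))) n.+1.
  have hzs := lincomb_submodule zsP hD.
  have hW := sat_saturated UD U1 UM (addm_submodule mO hzs).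
  apply: (@chain_le_subr _ _ _ _ _ (sat U (addm O (lincomb D zsP)))).
    apply: (sat_min hW); apply: (addm_min (proj1 hW)).
      by move=> x Ox; apply: (sat_sub U1); apply: (addmSl hzs).
    rewrite hE; apply: (span_min (proj1 hW)) => _ [c /gen[s [Bs nms hs]] <-].
    exists s%:P; first exact: polycomplC.
    rewrite -polyCM; case: hs => y hy [z hz ->]; rewrite polyCD.
    exists y%:P; first exact/subO/lincomb_const.
    by exists z%:P => //; apply: lincomb_const.
  move=> k ch; apply: leq_trans szs; rewrite -(size_map polyC).
  apply: (chain_le_lincomb Dring UD U1 UM hO _ ch) => d z Dd nUd.
  move=> /mapP[c czs ->]; apply: kill; last exact: zsA.
  by apply: contrapT => nPd; apply: nUd.
have [b hb] := eakin_sathaye UD U1 UM lY l_gen hD hO le_n.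
pose f := l b; have {hb} := hb b (leqnn b); rewrite -/f => hb.
pose W := scalem f (expand D (const a) n D).
have hW : submodule D W by apply/scalem_submodule/expand_submodule.
have gsE g : g \in gs -> expand D (const a) n.+1 D g%:P.
  by move=> ggs; rewrite hE; apply: span_sub; exists g => //; rewrite eA;
    apply: span_sub.
have hWP := addm_submodule hW hPgs; have hsWP := sat_saturated UD U1 UM hWP.
(* Each generator lies in the saturation of [W]; the product of the finitely many multipliers serves
   them all. *)
have [u Uu hu] : exists2 u, U u & forall z, z \in gsP -> W (u * z).
  apply: (sat_bound UD U1 UM hW); apply: (nakayama UD U1 UM hP _ _ hW).
  - by move=> p Pp i; apply: mB.
  - exact: polycomplB.
  - move=> _ /mapP[g ggs ->]; apply: (sat_min hsWP) (hb _ (gsE g ggs)).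
    apply: (addm_min (proj1 hsWP)).
      by apply: sat_mono; apply: (addmSr hW).
    by move=> x Wx; apply: (sat_sub U1); apply: (addmSl hPgs).
have Wu c : A n.+1 c -> W (u * c%:P).
  rewrite /A eA => hc.
  have hV : submodule B [set c | W (u * c%:P)].
    have := polyC_preimage_submodule (colonX_submodule u hW).
    by rewrite (_ : mkset _ = [set c | W (u * c%:P)]) //; apply/seteqP;
      split=> z /=; rewrite mulrC.
  by apply: (span_min hV _ hc) => g gg; apply/hu/map_f.
(* Applied to [w^(n+1)], this gives [u w^(n+1) = f h]; dividing by the unit [w^(n+1)] exhibits [u]
   as [f g]. *)
have [h hh eu] := Wu _ (powm_expr n.+1 (subring1 Bring) aw).
pose g := h * (w' ^+ n.+1)%:P.
have ufg : u = f * g.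
  rewrite mulrA -eu -mulrA -polyCM -exprMn ww' expr1n polyC1 mulr1 //.
(* For [c] in [a^(n+1)], regularity of [f] identifies [g c] with the quotient [h'] of [u c] by [f],
   whose coefficients lie in [a^n]. *)
have gK i : colon (A n) (A n.+1) g`_i.
  move=> c /Wu[h' hh' e]; rewrite -coefMC.
  have -> : g * c%:P = h'.
    have E : f * (g * c%:P) = f * h' by rewrite mulrA -ufg.
    exact: generic_form_reg ww' E.
  by move: hh'; rewrite hE => /(span_const_sub (hA n)).
have [i [nmi _]] := first_coef_notin Uu.
exists u`_i; split=> //; first by case: Uu.
rewrite ufg coefM; apply: submodule_sum; first exact: prodm_submodule.
move=> k _; apply: prodm_mul; last exact: gK.
exact: (span_const_sub ha (lY b)).
Qed.

End PrimeIdeal.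
End PolynomialModules.

(** Polynomials are formed over nonzero rings; the reduction is transported along this equality of
    ring structures. *)
Lemma nontrivial_comPzRing (Q : comPzRingType) : (1 : Q) != 0 ->
  exists N : comNzRingType, (N : comPzRingType) = Q.
Proof.
move=> h; pose N : comNzRingType := HB.pack (GRing.ComPzRing.sort Q)
  (GRing.ComPzRing.class Q) (GRing.PzSemiRing_isNonZero.Build Q h).
by exists N; case: Q h @N => T [].
Qed.

Lemma local_reduction_pz (Q : comPzRingType) (B m : set Q) :
  subring B -> submodule B m -> m `<=` B -> ~ m 1 ->
  (forall x y, B x -> B y -> m (x * y) -> m x \/ m y) ->
  forall (a : set Q) (ys gs zs : seq Q) (w w' : Q) (n : nat),
  a = span B [set` ys] -> a w -> w * w' = 1 ->
  powm B a n.+1 = span B [set` gs] ->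
  [set` zs] `<=` powm B a n.+1 -> (size zs <= n.+1)%N ->
  (forall x, powm B a n.+1 x -> exists s, [/\ B s, ~ m s &
     addm (lincomb m gs) (lincomb B zs) (s * x)]) ->
  exists s, [/\ B s, ~ m s &
    prodm B a (colon (powm B a n) (powm B a n.+1)) s].
Proof.
move=> Bring hm mB m1 mpr; have [N e] : exists N : comNzRingType,
  (N : comPzRingType) = Q.
  apply/nontrivial_comPzRing/eqP => e; apply: m1; rewrite e.
  exact: submodule0 hm.
case: Q / e B m Bring hm mB m1 mpr => B m Bring hm mB m1 mpr.
exact: (@local_reduction N B Bring m hm mB m1 mpr).
Qed.

(** * Denominators and finite generation in the total ring of fractions *)

Section TotalFractionRing.
Variable R : comPzRingType.
Notation Q := (totfrac R).
Notation B := (base R).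
Notation iota := (@toloc R (nonzerodiv R)).
Notation ideal := (submodule (setT : set R)).
Implicit Types (a A K M V : set Q) (m : maxIdeal R).

Lemma base_iota r : B (iota r). Proof. by exists r. Qed.

Lemma base_subring : subring B.
Proof.
split; first by exists 1; rewrite ?rmorph1.
  by move=> _ _ [x _ <-] [y _ <-]; exists (x - y); rewrite ?rmorphB.
by move=> _ _ [x _ <-] [y _ <-]; exists (x * y); rewrite ?rmorphM.
Qed.

Let hB := subring_submodule base_subring.

Lemma regular_unit s : s \in nonzerodiv R -> exists q, iota s * q = 1.
Proof.
move=> Ss; exists (frac 1 Ss).
by rewrite mulrC mul_frac_den rmorph1.
Qed.

Lemma unit_regular r (q : Q) : iota r * q = 1 -> r \in nonzerodiv R.
Proof.
move=> e; apply/nonzerodivP => y ry0; apply: (@toloc_totfrac_inj R).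
by rewrite rmorph0 -[LHS]mulr1 -e mulrA -rmorphM mulrC [y * r]mulrC ry0
  rmorph0 mulr0.
Qed.

Lemma unitX (w w' : Q) n : w * w' = 1 -> w ^+ n * w' ^+ n = 1.
Proof. by move=> e; rewrite -exprMn e expr1n. Qed.

Lemma frac_den (q : Q) : exists s, s \in nonzerodiv R /\ B (iota s * q).
Proof.
elim/locW: q => r s Ss; exists s; split=> //.
by rewrite mulrC mul_frac_den; apply: base_iota.
Qed.

Lemma common_den (s : seq Q) : exists d, d \in nonzerodiv R /\
  [set` s] `<=` [set x | B (iota d * x)].
Proof.
elim: s => [|x s [d [dreg hd]]]; first by exists 1; rewrite rpred1.
have [e [ereg he]] := frac_den x; exists (d * e); split; first exact: rpredM.
move=> y /=; rewrite inE rmorphM => /orP[/eqP->|/hd hy].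
  by rewrite -mulrA; apply: subringM base_subring _ _ _ he; apply: base_iota.
by rewrite mulrAC mulrC; apply: subringM base_subring _ _ _ hy;
  apply: base_iota.
Qed.

Lemma iota_preimage_submodule A : submodule B A -> ideal [set r | A (iota r)].
Proof.
move=> hA; split=> [|x y Ax Ay|c x _ Ax] /=.
- by rewrite rmorph0; apply: submodule0 hA.
- by rewrite rmorphD; apply: (submoduleD hA).
- by rewrite rmorphM; apply: (submoduleM hA) => //; apply: base_iota.
Qed.

Lemma iota_image_submodule (I : set R) : ideal I -> submodule B (iota @` I).
Proof.
move=> hI; split; first by exists 0; [apply: submodule0 hI|rewrite rmorph0].
  move=> _ _ [x Ix <-] [y Iy <-]; exists (x + y); rewrite ?rmorphD //.
  exact: (submoduleD hI).
move=> _ _ [c _ <-] [x Ix <-]; exists (c * x); rewrite ?rmorphM //.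
exact: (submoduleM hI).
Qed.

Lemma lincomb_iota (I : set R) zs x z : ideal I -> lincomb I zs x ->
  lincomb (iota @` I) [seq iota y * z | y <- zs] (iota x * z).
Proof.
move=> hI hx; have hV : ideal [set x |
    lincomb (iota @` I) [seq iota y * z | y <- zs] (iota x * z)].
  have := lincomb_submodule [seq iota y * z | y <- zs] (iota_image_submodule
    hI).
  by move=> /(colonX_submodule z)/iota_preimage_submodule.
apply: (lincomb_min hV _ hx) => c y Ic yzs /=; rewrite rmorphM -mulrA.
apply: (lincomb_mem (iota_image_submodule hI)); first by exists c.
by apply/mapP; exists y.
Qed.

(** The unit [w] makes [A] isomorphic to the ideal [w A] of [R], whose generators divided by [w]
    generate [A]. *)
Lemma fg_of_scaled_sub A (w w' : Q) : noetherian_ring R -> submodule B A ->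
  w * w' = 1 -> (forall x, A x -> B (w * x)) -> exists s : seq Q,
    A = span B [set` s].
Proof.
move=> noethR hA ww' wA.
have hI : ideal [set r | A (iota r * w')].
  exact: (iota_preimage_submodule (colonX_submodule w' hA)).
have [_ [zs _ eI]] := noethR _ hI (@subsetT _ _).
exists [seq iota z * w' | z <- zs]; apply/seteqP; split.
  move=> x Ax; have [r _ er] := wA x Ax.
  have ex : x = iota r * w' by rewrite er mulrAC ww' mul1r.
  have Ir : [set r | A (iota r * w')] r by rewrite /= -ex.
  move: Ir; rewrite eI (span_seq _ (subring1 (setT_subring R))
    (subring_submodule (setT_subring R))).
  move=> /(lincomb_iota w' (subring_submodule (setT_subring R))).
  by rewrite -ex (span_seq _ (subring1 base_subring) hB).
apply: span_min => // _ /mapP[z zzs ->].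
by have : [set r | A (iota r * w')] z by rewrite eI; apply: span_sub.
Qed.

Lemma powm_scaled_sub a n (d : Q) : (forall x, a x -> B (d * x)) ->
  forall x, powm B a n x -> B (d ^+ n * x).
Proof.
move=> da; elim: n => [|n IH] x; first by rewrite expr0 mul1r.
have hV : submodule B [set x | B (x * d ^+ n.+1)] by apply: colonX_submodule.
move=> /(prodm_min hV) h; rewrite mulrC; apply: h => b y /IH hb /da hy /=.
have -> : b * y * d ^+ n.+1 = (d ^+ n * b) * (d * y) by rewrite exprS; ring.
exact: subringM base_subring _ _ hb hy.
Qed.

End TotalFractionRing.

(** * Units in fractional ideals, and inverses locally at a maximal ideal *)

Lemma exprD_nilpotent (Q : comPzRingType) (x y : Q) k l :
  x ^+ k = 0 -> y ^+ l = 0 -> (x + y) ^+ (k + l) = 0.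
Proof.
move=> xk yl; rewrite exprDn big1 // => -[i /= ilt] _.
have [li|il] := leqP l i; first by rewrite -(subnK li) exprD yl mulr0 mulr0
  mul0rn.
by rewrite -(@subnK k (k + l - i)) ?exprD ?xk ?mulr0 ?mul0r ?mul0rn //; lia.
Qed.

(** The ideals [z^i Q] stabilize, so [z^M = z^(2M) x] for [M = N + 1]. Then [z^M x] is an idempotent
    splitting [Q] into a factor where [z] is a unit and one where it is nilpotent. *)
Lemma artinian_fitting (Q : comPzRingType) (z : Q) : artinian_ring Q ->
  exists e p k, [/\ e * e = e, z * p = e & z ^+ k * (1 - e) = 0].
Proof.
move=> artQ; pose I i : set Q := scalem (z ^+ i) setT.
have [i|i|N stab] := artQ I.
- exact/scalem_submodule/subring_submodule/setT_subring.
- by move=> _ [x _ ->]; exists (z * x); rewrite // exprSr mulrA.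
have : I N.+1 (z ^+ N.+1) by exists 1; rewrite ?mulr1.
rewrite stab // -(stab (N.+1 + N.+1)%N); last by lia.
case=> x _; rewrite exprD => ex.
exists (z ^+ N.+1 * x), (z ^+ N * x), N.+1; split.
- by rewrite [RHS](congr1 ( *%R^~ x) ex); ring.
- by rewrite exprS mulrA.
- by rewrite mulrBr mulr1 {1}ex; ring.
Qed.

Section FractionalIdeals.
Variable R : comPzRingType.
Hypothesis noethR : noetherian_ring R.
Notation Q := (totfrac R).
Notation B := (base R).
Notation iota := (@toloc R (nonzerodiv R)).
Notation ideal := (submodule (setT : set R)).
Implicit Types (a A K V : set Q) (m : maxIdeal R).

Let Bring := base_subring R.
Let hB := subring_submodule Bring.

(* An idempotent [e] such that some [z] in [a] is invertible on [e Q] can be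
   enlarged as long as some [y] in [a] is not nilpotent on [(1 - e) Q]. *)
Lemma exists_unit_mem a : artinian_ring Q -> submodule B a ->
  prodm B a setT = setT -> exists w w', a w /\ w * w' = 1.
Proof.
move=> artQ ha aQ.
pose G e := e * e = e /\ exists z q, a z /\ z * q = e.
(* Idempotents are compared through these ideals of [R], among which the Noetherian condition
   provides a maximal one. *)
pose ann (e : Q) := [set r | iota r * (1 - e) = 0].
pose F := [set I | exists2 e, G e & I = ann e].
have hF I : F I -> ideal I.
  move=> [e _ ->]; have h0 : submodule B [set 0 : Q].
    by split=> [//|_ _ -> ->|c _ _ ->]; rewrite ?addr0 ?mulr0.
  exact: (iota_preimage_submodule (colonX_submodule (1 - e) h0)).
have F0 : F (ann 0).
  exists 0 => //; split; first by rewrite mulr0.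
  by exists 0, 0; rewrite mulr0; split=> //; apply: submodule0 ha.
have [_ [[e [ee [z [q [az zq]]]] ->] _ emax]] :=
  noetherian_maximal noethR hF F0.
have [e1|ne1] := pselect (e = 1); first by exists z, q; rewrite zq e1.
exfalso; pose f := 1 - e.
have fe : f * e = 0 by rewrite /f mulrBl mul1r ee subrr.
have ff : f * f = f by rewrite {2}/f mulrBr mulr1 fe subr0.
(* If all of [a] were nilpotent on [f Q], then so would be [a Q = Q], and the idempotent [f] would
   vanish. *)
pose nil := [set y : Q | exists k, (f * y) ^+ k = 0].
have hnil : submodule setT nil.
  split; first by exists 1%N; rewrite mulr0.
    by move=> x y [k xk] [l yl]; exists (k + l)%N;
      rewrite mulrDr exprD_nilpotent.
  by move=> c y _ [k yk]; exists k; rewrite mulrCA exprMn yk mulr0.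
have [y ay ynil] : exists2 y, a y & ~ nil y.
  apply: contrapT => h; have anil y : a y -> nil y.
    by move=> ay; apply: contrapT => ny; apply: h; exists y.
  have hnilB : submodule B nil by case: hnil => ? ? hM; split=> // c x _;
    apply: hM.
  have : prodm B a setT 1 by rewrite aQ.
  case/(prodm_min hnilB) => [x c /anil nx _|k]; first by rewrite mulrC;
    apply: (submoduleM hnil).
  have fX i : f ^+ i.+1 = f by elim: i => [|i IH]; rewrite ?expr1 // exprS IH.
  rewrite mulr1 => fk; apply: ne1; apply/esym/subr0_eq; rewrite -/f.
  by rewrite -(fX k) exprS fk mulr0.
have [e1 [p [k [ee1 tp tk]]]] := artinian_fitting (f * y) artQ.
have e1f : e1 * f = e1 by rewrite -tp -[RHS](congr1 (fun f => f * y * p) ff);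
  ring.
have e1e : e1 * e = 0 by rewrite -e1f -mulrA fe mulr0.
have e10 : e1 <> 0 by move=> e10; apply: ynil; exists k;
  rewrite -tk e10 subr0 mulr1.
(* [e] and [f] may have denominators; the factor [s] keeps the combination of [z] and [y] in [a]. *)
have [s [sreg Bse]] := frac_den e; have [s' ss'] := regular_unit sreg.
pose e' := e + e1.
have ee' : e' * e' = e'.
  have -> : e' * e' = e * e + e1 * e1 + e1 * e + e1 * e by rewrite /e'; ring.
  by rewrite ee ee1 e1e !addr0.
have Ge' : G e'.
  split=> //; pose z' := iota s * e * z + iota s * f * y.
  exists z', (s' * (q * e + p * e1)); split.
    apply: (submoduleD ha); apply: (submoduleM ha) => //.
    by rewrite /f mulrBr mulr1; apply: (subringB Bring) => //;
      apply: base_iota.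
  have -> : z' * (s' * (q * e + p * e1)) = iota s * s' * (e * e * (z * q) +
      e1 * e * z * p + (f * e) * y * q + (f * y * p) * e1) by rewrite /z';
        ring.
  by rewrite ss' zq ee e1e fe tp ee1 ee /e'; ring.
(* The numerator [r] of [e'] is killed by [1 - e'], but by [1 - e] only if [e1 = 0]: so [ann e']
   exceeds [ann e]. *)
have [s1 [s1reg [r _ er]]] := frac_den e';
  have [s1' ss1'] := regular_unit s1reg.
have : ann e' `<=` ann e.
  apply: emax; first by exists e'.
  move=> x; rewrite /ann /= -/f => xe;
    have -> : 1 - e' = f - e1 by rewrite /e' /f; ring.
  by rewrite mulrBr xe -e1f [e1 * f]mulrC mulrA xe mul0r subr0.
move/(_ r); rewrite /ann /= er -!mulrA => h.
have {}h : iota s1 * (e' * (1 - e)) = 0.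
  by apply: h; rewrite mulrBr mulr1 ee' subrr mulr0.
apply: e10; rewrite -e1f; have -> : e1 * f = e' * (1 - e).
  by rewrite -/f /e' mulrDl [e * f]mulrC fe add0r.
by rewrite -[RHS](mulr0 s1') -h mulrA [s1' * _]mulrC ss1' mul1r.
Qed.

Lemma mem_of_local V : submodule B V ->
  (forall m, exists s, ~ maxideal_set m s /\ V (iota s)) -> V 1.
Proof.
move=> hV loc1; apply: contrapT => nV1; have hI := iota_preimage_submodule hV.
have [|m Im] := exists_maxIdeal noethR hI; first by rewrite /= rmorph1.
by have [s [ns Vs]] := loc1 m; apply: ns; apply: Im.
Qed.

(** Since [d a <= R], [I] is the ideal [d^(n+1) a^(n+1)] of [R]; as [c] is in [m], generation modulo
    [c I] is generation modulo [m I], which [local_reduction_pz] requires. *)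
Lemma local_inverse m a (ys : seq Q) (w w' d' : Q) d c n :
  a = span B [set` ys] -> a w -> w * w' = 1 -> iota d * d' = 1 ->
  (forall x, a x -> B (iota d * x)) -> maxideal_set m c ->
  let I := [set r | powm B a n.+1 (iota r * d' ^+ n.+1)] in
  (exists zs, [/\ (size zs <= n.+1)%N, [set` zs] `<=` I & forall x, I x ->
     exists s, ~ maxideal_set m s /\
       addm (scalem c I) (lincomb setT zs) (s * x)]) ->
  exists s, ~ maxideal_set m s /\
    prodm B a (colon (powm B a n) (powm B a n.+1)) (iota s).
Proof.
move=> ea aw ww' dd' da mc I [zs [sz zsI gen]].
have [hm m1 mpr] := maxIdeal_prime m.
pose M := iota @` maxideal_set m.
have hM : submodule B M by apply: iota_image_submodule.
have Miota r : M (iota r) -> maxideal_set m r by move=> [x mx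
  /toloc_totfrac_inj <-].
have MB : M `<=` B by move=> _ [x _ <-]; apply: base_iota.
have M1 : ~ M 1 by rewrite -(rmorph1 iota) => /Miota.
have Mpr x y : B x -> B y -> M (x * y) -> M x \/ M y.
  move=> [x' _ <-] [y' _ <-]; rewrite -rmorphM => /Miota/mpr[?|?];
    [left|right].
    by exists x'.
  by exists y'.
have hA : submodule B (powm B a n.+1) by apply: powm_submodule.
have dn := powm_scaled_sub (n := n.+1) da.
have ddn := unitX n.+1 dd'.
have [gs egs] := fg_of_scaled_sub noethR hA ddn dn.
pose zsQ := [seq iota z * d' ^+ n.+1 | z <- zs].
have [||x Ax|s [[s' _ <-] ns hs]] :=
  local_reduction_pz Bring hM MB M1 Mpr (zs := zsQ) ea aw ww' egs.
- by move=> _ /mapP[z /zsI Iz ->].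
- by rewrite size_map.
- have [r _ er] := dn x Ax.
  have ex : x = iota r * d' ^+ n.+1 by rewrite er mulrAC ddn mul1r.
  have [|s [ns [_ [i Ii ->] [l hl esx]]]] := gen r; first by rewrite /I /= -ex.
  exists (iota s); split; [exact: base_iota|by move/Miota|].
  have -> : iota s * x = iota c * (iota i * d' ^+ n.+1) + iota l * d' ^+ n.+1.
    by rewrite ex mulrA -rmorphM esx rmorphD rmorphM; ring.
  exists (iota c * (iota i * d' ^+ n.+1)).
    have hV : submodule B [set y | lincomb M gs (y * iota c)].
      exact/colonX_submodule/lincomb_submodule.
    have : powm B a n.+1 (iota i * d' ^+ n.+1) := Ii.
    rewrite egs [iota c * _]mulrC => /(span_min hV); apply => g ggs /=.
    by rewrite mulrC; apply: (lincomb_mem hM) => //; exists c.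
  exists (iota l * d' ^+ n.+1) => //.
  exact: (lincomb_iota _ (subring_submodule (setT_subring R)) hl).
by exists s'; split=> // ms'; apply: ns; exists s'.
Qed.

End FractionalIdeals.

(** * Descent from [R_m] and [Q(R_m)] to [R] and [Q(R)] *)

Section LocalizationAtMaximalIdeal.
Variables (R : comPzRingType) (m : maxIdeal R).
Notation Q := (totfrac R).
Notation B := (base R).
Notation iota := (@toloc R (nonzerodiv R)).
Notation ideal := (submodule (setT : set R)).
Notation Rm := (locmax m).
Notation mu := (@toloc R (maxcompl m)).
Notation phi := (totfrac_map m).
Implicit Types (a V : set Q).

Lemma addr_frac (S : mulrClosed R) r s (Ss : s \in S) r' s' (Ss' : s' \in S) :
  frac r Ss + frac r' Ss' = frac (r * s' + r' * s) (rpredM Ss Ss').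
Proof. exact: addloc_frac. Qed.

Lemma notin_maxIdealM s t : ~ maxideal_set m s -> ~ maxideal_set m t ->
  ~ maxideal_set m (s * t).
Proof. by have [_ _ mpr] := maxIdeal_prime m; move=> ns nt /mpr[]. Qed.

Lemma notin_maxIdeal1 : ~ maxideal_set m 1.
Proof. by have [] := maxidealP m. Qed.

(** Generators of [I R_m] are fractions with numerators in [I], and an equality of fractions holds
    in [R] after multiplication by an element outside [m]. *)
Lemma num_gens_local N (I : set R) : enat_le (num_gens m) N -> ideal I ->
  exists zs, [/\ (size zs <= N)%N, [set` zs] `<=` I &
    forall x, I x -> exists s, ~ maxideal_set m s /\ lincomb setT zs (s * x)].
Proof.
move=> le_N hI; have [j jN gens_j] : exists2 j, (j <= N)%N &
    forall J : set Rm, submodule setT J -> generated_by setT J j.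
  move: le_N; rewrite /num_gens /enat_min; case: pselect => //= h.
  by case: ex_minnP => j /asboolP Pj _ jN; exists j.
pose fracs (A : set R) : set Rm :=
  [set y | exists2 r, A r & exists t (Tt : t \in maxcompl m), y = frac r Tt].
have hfracs A : ideal A -> submodule setT (fracs A).
  move=> hA; split.
  - by exists 0; [apply: submodule0 hA|exists 1, (rpred1 (maxcompl m))].
  - move=> _ _ [r Ar [t [Tt ->]]] [r' Ar' [t' [Tt' ->]]].
    exists (r * t' + r' * t); last by exists (t * t'), (rpredM Tt Tt');
      rewrite addr_frac.
    by apply: (submoduleD hA); rewrite mulrC; apply: (submoduleM hA).
  - move=> c _ _ [r Ar [t [Tt ->]]]; elim/locW: c => u v Sv.
    exists (u * r); first exact: (submoduleM hA).
    by exists (v * t), (rpredM Sv Tt); rewrite mulr_frac.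
have [s ss eJ] := gens_j _ (hfracs I hI).
have [zs [szs zsI szsF]] : exists zs, [/\ size zs = size s, [set` zs] `<=` I &
    [set` s] `<=` fracs [set` zs]].
  have : [set` s] `<=` fracs I by rewrite eJ; apply: span_sub.
  elim: s {ss eJ} => [|y s IH] sI; first by exists [::].
  have [|zs [szs zsI szsF]] := IH.
    by move=> x xs; apply: sI; rewrite /= inE xs orbT.
  have [r Ir [t [Tt ey]]] : fracs I y by apply: sI; rewrite /= inE eqxx.
  exists (r :: zs); split; first by rewrite /= szs.
    by move=> x /=; rewrite inE => /orP[/eqP->|/zsI].
  move=> x /=; rewrite inE => /orP[/eqP->|/szsF[r' r'zs h]].
    by exists r; [rewrite /= inE eqxx|exists t, Tt].
  by exists r'; first by rewrite /= inE r'zs orbT.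
exists zs; split=> [||x Ix]; rewrite ?szs ?ss //.
have hT := subring_submodule (setT_subring R).
have hL := lincomb_submodule zs hT.
have sL : span setT [set` s] `<=` fracs (lincomb setT zs).
  apply: (span_min (hfracs _ hL)) => y /szsF[r rzs h]; exists r => //.
  by rewrite -[r]mul1r; apply: (lincomb_mem hT).
have [r hr [t [Tt ex]]] : fracs (lincomb setT zs) (mu x).
  by apply: sL; rewrite -eJ; exists x => //; exists 1, (rpred1 (maxcompl m)).
move/frac_eqP: ex => [u /maxcomplP nu e]; move/maxcomplP: Tt => nt.
exists (u * t); split; first exact: notin_maxIdealM.
rewrite -mulrA [t * x]mulrC e mulr1; exact: (submoduleM hL).
Qed.

Lemma totfrac_map_frac r s (Ss : s \in nonzerodiv R) :
  phi (frac r Ss) = frac (mu r) (toloc_maxcompl_reg m Ss).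
Proof. exact: locmap_frac. Qed.

Lemma totfrac_map_iota r : phi (iota r) = toloc _ (mu r).
Proof.
rewrite totfrac_map_frac; apply/frac_eqP; exists 1; first exact: rpred1.
by rewrite !rmorph1.
Qed.

Lemma totfrac_mapD x y : phi (x + y) = phi x + phi y.
Proof.
elim/locW: x => r s Ss; elim/locW: y => r' s' Ss'.
rewrite addr_frac !totfrac_map_frac -[RHS]/(addloc _ _) addloc_frac.
by apply/frac_eqP; exists 1; rewrite ?rpred1 // !rmorphD !rmorphM.
Qed.

Lemma totfrac_mapM x y : phi (x * y) = phi x * phi y.
Proof.
elim/locW: x => r s Ss; elim/locW: y => r' s' Ss'.
rewrite mulr_frac !totfrac_map_frac mulr_frac.
by apply/frac_eqP; exists 1; rewrite ?rpred1 // !rmorphM.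
Qed.

(** The numerator of [x] vanishes in [R_m], because [R_m] embeds into [Q(R_m)]. *)
Lemma totfrac_map_eq0 x : phi x = 0 ->
  exists u, ~ maxideal_set m u /\ iota u * x = 0.
Proof.
elim/locW: x => r s Ss x0.
have : toloc (nonzerodiv Rm) (mu r) = toloc _ (mu 0).
  by rewrite -(totfrac_map_iota r) -(mul_frac_den r Ss) totfrac_mapM x0 mul0r
    !rmorph0.
move/toloc_totfrac_inj; rewrite rmorph0 => /toloc_eq0[u /maxcomplP nu ur0].
exists u; split=> //; rewrite mulr_frac ur0.
by rewrite -[RHS]/(toloc _ 0); apply/frac_eqP; exists 1;
  rewrite ?rpred1 ?mul0r.
Qed.

(** If [phi y = r / t], then [t y - r] lies in the kernel of [phi]. *)
Lemma totfrac_map_base y : base Rm (phi y) ->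
  exists t, ~ maxideal_set m t /\ B (iota t * y).
Proof.
move=> [x _]; elim/locW: x => r t Tt e.
have [u [nu]] : exists u, ~ maxideal_set m u /\ iota u * (iota t * y - iota r)
  = 0.
  apply: totfrac_map_eq0; have ->
    : iota t * y - iota r = iota t * y + iota (- r).
    by rewrite rmorphN.
  rewrite totfrac_mapD totfrac_mapM !totfrac_map_iota -e -rmorphM.
  by rewrite [mu t * _]mulrC mul_frac_den -rmorphD -rmorphD subrr !rmorph0.
rewrite mulrBr => /subr0_eq e'; exists (u * t); split.
  by apply: notin_maxIdealM => //; apply/maxcomplP.
by rewrite rmorphM -mulrA e' -rmorphM; apply: base_iota.
Qed.

(** The elements carried into [phi a] by a multiplier outside [m] form an [R_m]-submodule [V]
    containing [a_m], hence [1]. So some [x] in [a] agrees with some [t] outside [m], up to the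
    kernel of [phi]. *)
Lemma local_at_base_mem a : submodule B a -> local_at m a = base Rm ->
  exists t, ~ maxideal_set m t /\ a (iota t).
Proof.
move=> ha ea; pose V : set (totfrac Rm) :=
  [set y | exists t, ~ maxideal_set m t /\
  exists2 x, a x & toloc _ (mu t) * y = phi x].
have hV : submodule (base Rm) V.
  split.
  - exists 1; split; first exact: notin_maxIdeal1.
    exists 0; first exact: submodule0 ha.
    by rewrite mulr0 -(rmorph0 iota) totfrac_map_iota !rmorph0.
  - move=> y y' [t [nt [x ax e]]] [t' [nt' [x' ax' e']]].
    exists (t * t'); split; first exact: notin_maxIdealM.
    exists (iota t' * x + iota t * x').
      by apply: (submoduleD ha); apply: (submoduleM ha) => //;
        apply: base_iota.
    by rewrite totfrac_mapD !totfrac_mapM -e -e' !totfrac_map_iota !rmorphM;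
      ring.
  - move=> _ y [c _ <-] [t [nt [x ax e]]]; elim/locW: c => r u Tu.
    exists (u * t); split; first by apply: notin_maxIdealM => //;
      apply/maxcomplP.
    exists (iota r * x); first by apply: (submoduleM ha) => //;
      apply: base_iota.
    rewrite totfrac_mapM -e totfrac_map_iota -(mul_frac_den r Tu) !rmorphM.
    by ring.
have : local_at m a 1 by rewrite ea; exists 1; rewrite ?rmorph1.
case/(span_min hV) => [_ [x ax <-]|t [nt [x ax]]].
  exists 1; split; first exact: notin_maxIdeal1.
  by exists x; rewrite // !rmorph1 mul1r.
rewrite mulr1 => e.
have [u [nu]] : exists u, ~ maxideal_set m u /\ iota u * (x + iota (- t)) = 0.
  by apply: totfrac_map_eq0; rewrite totfrac_mapD -e totfrac_map_iota
    -!rmorphD subrr !rmorph0.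
rewrite rmorphN mulrBr => /subr0_eq e'; exists (u * t); split.
  exact: notin_maxIdealM.
by rewrite rmorphM -e'; apply: (submoduleM ha) => //; apply: base_iota.
Qed.

Lemma local_at_base_sub a (ys : seq Q) : a = span B [set` ys] ->
  local_at m a = base Rm ->
  exists t, ~ maxideal_set m t /\ forall x, a x -> B (iota t * x).
Proof.
move=> ea la; have : [set` ys] `<=` a by rewrite ea; apply: span_sub.
have Bring := base_subring R; have hB := subring_submodule Bring.
move=> ysa; suff [t [nt ht]] : exists t, ~ maxideal_set m t /\
    forall y, y \in ys -> B (iota t * y).
  exists t; split=> // x; rewrite ea mulrC => hx.
  by apply: (span_min (colonX_submodule (iota t) hB) _ hx) => y /= /ht;
    rewrite mulrC.
elim: ys ysa {ea} => [|y ys IH] ysa.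
  by exists 1; split=> //; apply: notin_maxIdeal1.
have [|t [nt ht]] := IH; first by move=> x xys; apply: ysa;
  rewrite /= inE xys orbT.
have [|t' [nt' ht']] := @totfrac_map_base y.
  rewrite -la; apply: span_sub; exists y => //.
  by apply: ysa; rewrite /= inE eqxx.
exists (t * t'); split; first exact: notin_maxIdealM.
move=> x; rewrite inE rmorphM => /orP[/eqP->|/ht h].
  by rewrite -mulrA; apply: (submoduleM hB) => //; apply: base_iota.
by rewrite mulrAC mulrC; apply: (submoduleM hB) => //; apply: base_iota.
Qed.

End LocalizationAtMaximalIdeal.

(** * Invertibility of [a] over the rings between [R] and [Q] *)

Section InvertibleOver.
Variable R : comPzRingType.
Notation Q := (totfrac R).
Notation B := (base R).
Notation iota := (@toloc R (nonzerodiv R)).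
Implicit Types (a A K S T V : set Q).

Let Bring := base_subring R.
Let hB := subring_submodule Bring.

Lemma intermediate_subring S : intermediate_ring S -> subring S.
Proof.
by move=> [BS hS hM]; split=> //; apply: BS; apply: subring1.
Qed.

Lemma submodule_sub S V : B `<=` S -> submodule S V -> submodule B V.
Proof. by move=> BS [h0 hD hM]; split=> // c x /BS; apply: hM. Qed.

Lemma colon_intermediate_ring A : submodule B A ->
  intermediate_ring (colon A A).
Proof.
move=> hA; split=> [b Bb x|x y hx hy b Ab|x y hx hy b Ab].
- exact: (submoduleM hA).
- by rewrite mulrBl; apply: (submoduleB Bring hA); [apply: hx|apply: hy].
- by rewrite -mulrA; apply/hx/hy.
Qed.

(** [t] brings one factor of [a^(n+1)] into [R]; this handles the maximal ideals where [a] is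
    locally trivial. *)
Lemma colon_powmS_mem a n t : submodule B a -> (forall x, a x -> B (t * x)) ->
  colon (powm B a n) (powm B a n.+1) t.
Proof.
move=> ha ta b hb; have hA : submodule B (powm B a n) by apply: powm_submodule.
have hV := colonX_submodule t hA; rewrite mulrC; apply: (prodm_min hV _ hb).
move=> x y Ax /ta Bty /=; have -> : x * y * t = t * y * x by ring.
exact: (submoduleM hA).
Qed.

(** The inverse of [S a] is [K]: an element of [a] sends [a^n] into [a^(n+1)] and one of [K] sends
    it back, so [a K <= S]; the hypothesis gives the converse. *)
Lemma invertible_over_colon a n : submodule B a ->
  prodm B a (colon (powm B a n) (powm B a n.+1)) 1 ->
  invertible_over a (colon (powm B a n) (powm B a n)).
Proof.
move=> ha; set A := powm B a n; set K := colon A _ => K1.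
have hA : submodule B A by apply: powm_submodule.
have hS := colon_intermediate_ring hA; set S := colon A A in hS *.
have Sring := intermediate_subring hS; have hSS := subring_submodule Sring.
have [BS _ _] := hS; split=> //; split; first exact: span_submodule.
have hK : submodule S K.
  split=> [b _|x y Kx Ky b Ab|s x Ss Kx b Ab].
  - by rewrite mul0r; apply: submodule0 hA.
  - by rewrite mulrDl; apply: (submoduleD hA); [apply: Kx|apply: Ky].
  - by rewrite -mulrA; apply/Ss/Kx.
exists K => //; apply/seteqP; split.
  apply: prodm_min => // x y hx Ky.
  apply: (span_min (colonX_submodule y hSS) _ hx) => z az c Ac.
  have -> : z * y * c = y * (c * z) by ring.
  by apply: Ky; exact: (@prodm_mul _ B A a c z Ac az).
move=> s Ss; rewrite -[s]mulr1; apply: (submoduleM (prodm_submodule _ _ _) Ss).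
have hP := submodule_sub BS (prodm_submodule S (span S a) K).
apply: (prodm_min hP _ K1) => x y ax Ky; apply: prodm_mul => //.
exact: span_sub.
Qed.

(* Cancel the invertible ideal [T a] from [x (T a)^n <= (T a)^n]. *)
Lemma colon_sub_invertible_over a T n : submodule B a -> invertible_over a T ->
  colon (powm B a n) (powm B a n) `<=` T.
Proof.
move=> ha [hT [_ [C hC TaC]]]; have Tring := intermediate_subring hT.
have hTT := subring_submodule Tring; have [BT _ _] := hT.
(* With [T]-spans on the right, one factor [a] is cancelled at a time, down to [a^0 = R], where
   [b = 1] gives [x] in [T]. *)
suff cancel x k : (forall b, powm B a k b ->
  span T (powm B a k) (x * b)) -> T x.
  by move=> x hx; apply: (cancel x n) => b Ab; apply: span_sub; apply: hx.
elim: k => [h|k IH h].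
  by rewrite -[x]mulr1; apply: (span_min hTT BT (h 1 _)); apply: subring1.
apply: IH => b Ab; have hA := span_submodule T (powm B a k).
have hV : submodule T [set q | span T (powm B a k) (q * (x * b))].
  exact: colonX_submodule.
(* Write [1] through products [z c] with [z] in [a] and [c] in [C]: [x b z] lies in [T a^(k+1)], and
   [c] returns it to [T a^k]. *)
have T1 : prodm T (span T a) C 1 by rewrite TaC; apply: subring1.
rewrite -[x * b]mul1r; apply: (prodm_min hV _ T1) => y c hy Cc /=.
rewrite -mulrA; apply: (span_min (colonX_submodule _ hA) _ hy) => z az /=.
have Ac : span T (powm B a k.+1) `<=` [set q | span T (powm B a k) (q * c)].
  apply: (span_min (colonX_submodule _ hA)).
  apply: (prodm_min (submodule_sub BT (colonX_submodule _ hA))) =>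
    u v Au av /=.
  rewrite -mulrA mulrC; apply: (submoduleM hA); last exact: span_sub.
  by rewrite -TaC; apply: prodm_mul => //; apply: span_sub.
have -> : z * (c * (x * b)) = x * (b * z) * c by ring.
by apply: Ac; apply: h; exact: (@prodm_mul _ B _ a b z Ab az).
Qed.

(** As [w^n] is in [a^n], the unit [(d w)^n] carries [a^n : a^n] into [R], so every submodule is
    isomorphic to an ideal of [R]. *)
Lemma colon_powm_noetherian a n (d w d' w' : Q) : noetherian_ring R ->
  submodule B a -> (forall x, a x -> B (d * x)) -> a w -> d * d' = 1 ->
  w * w' = 1 -> noetherian_module B (colon (powm B a n) (powm B a n)).
Proof.
move=> noethR ha da aw dd' ww' V hV VS.
have dw : (d ^+ n * w ^+ n) * (d' ^+ n * w' ^+ n) = 1.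
  by rewrite mulrACA !unitX ?mulr1.
have [x Vx|s eV] := fg_of_scaled_sub noethR hV dw.
  rewrite -mulrA [w ^+ n * x]mulrC; apply: (powm_scaled_sub da).
  by apply: VS Vx _ _; apply: powm_expr aw; apply: subring1.
by exists (size s), s.
Qed.

End InvertibleOver.

Theorem theorem1p4 (R : comPzRingType) (a : set (totfrac R)) :
  noetherian_ring R -> krull_dim_le R 1 -> artinian_ring (totfrac R) ->
  fractional_ideal a ->
  exists S : set (totfrac R),
    [/\ unique (least_invertible_over a) S,
        noetherian_module (base R) S
      & forall n : nat, enat_le (num_gens_frac a) n.+1 ->
          S = colon (powm (base R) a n) (powm (base R) a n)].
Proof.
move=> noethR dimR artQ [ha [_ [ys _ ea]] aQ].
have Bring := base_subring R; have hB := subring_submodule Bring.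
have [w [w' [aw ww']]] := exists_unit_mem noethR artQ ha aQ.
have [d [dreg hd]] := common_den ys; have [d' dd'] := regular_unit dreg.
set iota := toloc (nonzerodiv R).
have da x : a x -> base R (iota d * x).
  rewrite ea mulrC => hx; apply: (span_min (colonX_submodule (iota d) hB) _
    hx).
  by move=> y /hd /=; rewrite mulrC.
pose A k := powm (base R) a k; pose S k := colon (A k) (A k).
have least n : (forall m : maxIdeal R, exists s, ~ maxideal_set m s /\
    prodm (base R) a (colon (A n) (A n.+1)) (iota s)) ->
    least_invertible_over a (S n).
  move=> loc1; split; last by move=> T; apply: colon_sub_invertible_over.
  by apply: invertible_over_colon => //; apply: mem_of_local loc1 => //;
    apply: prodm_submodule.
have uniq_least T T' : least_invertible_over a T ->
  least_invertible_over a T' -> T = T'.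
  by move=> [iT lT] [iT' lT']; apply/seteqP; split; [exact: lT|exact: lT'].
(* [c = d w] lies in [R] and is a unit of [Q], hence regular. As [w] is in [a] and [d a <= R], it
   also lies in [a * K n] for every [n]. *)
have [c _ ec] := da w aw; rewrite -/iota in ec.
have cc' : iota c * (d' * w') = 1 by rewrite ec mulrACA dd' ww' mulr1.
have creg := unit_regular cc'.
have [e gens_e] := gens_mod_regular noethR dimR creg.
(* The exponent is [e] itself: at most [e] generators are needed modulo [c I], one fewer than the
   [e + 1] allowed. *)
have leastS : least_invertible_over a (S e).
  apply: least => m; have [mc|nmc] := pselect (maxideal_set m c); last first.
    exists c; split=> //; rewrite ec mulrC; apply: prodm_mul => //.
    exact: colon_powmS_mem.
  apply: (local_inverse noethR ea aw ww' dd' da mc).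
  set I := [set r | _]; have hI : submodule setT I.
    exact: (iota_preimage_submodule (colonX_submodule (d' ^+ e.+1)
      (powm_submodule a e.+1 hB))).
  have Ic : I (c ^+ e.+1).
    rewrite /I [_ _]/= rmorphXn /= -exprMn -/iota ec.
    have -> : iota d * w * d' = w by rewrite mulrAC dd' mul1r.
    exact: (powm_expr e.+1 (subring1 Bring) aw).
  have [zs [sz zsI gen]] := gens_e _ _ (rpredX e.+1 creg) hI Ic.
  exists zs; split=> // [|x Ix]; first exact: leqW.
  by exists 1; rewrite mul1r; split; [exact: notin_maxIdeal1|exact: gen].
exists (S e); split; first by split=> // T; apply: uniq_least.
  exact: colon_powm_noetherian noethR ha da aw dd' ww'.
(* It suffices that [S n] is also least. *)
move=> n le_n; apply: uniq_least leastS _; apply: least => m.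
have [la|nla] := pselect (local_at m a = base (locmax m)).
  have [t [nt at_]] := local_at_base_mem ha la.
  have [u [nu ua]] := local_at_base_sub ea la.
  (* [t] lies in [a], and [u a <= R] puts [u] in [K n]. *)
  exists (t * u); split; first exact: notin_maxIdealM.
  by rewrite /iota rmorphM; apply: prodm_mul => //; apply: colon_powmS_mem.
have {le_n} le_n : enat_le (num_gens m) n.+1.
  move: le_n; rewrite /num_gens_frac /enat_min; case: pselect => //= h.
  case: ex_minnP => j /asboolP /(_ m nla) + _ jn.
  by case: (num_gens m) => //= k kj; apply: leq_trans jn.
have [m0 m1 _] := maxidealP m.
(* Here [c = 0]: the [zs] generate [I] locally at [m] without any correction from [c I]. *)
apply: (local_inverse noethR ea aw ww' dd' da (submodule0 m0)).
set I := [set r | _]; have hI : submodule setT I.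
  exact: (iota_preimage_submodule (colonX_submodule (d' ^+ n.+1)
    (powm_submodule a n.+1 hB))).
have [zs [sz zsI gen]] := num_gens_local le_n hI.
exists zs; split=> // x /gen[s [ns hs]]; exists s; split=> //.
exact: addmSr (scalem_submodule _ hI) _ hs.
Qed.
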